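(* For any two quantum channels $\mathcal{T}:\mathcal{M}_d\to\mathcal{M}_d$ and $\mathcal{S}:\mathcal{M}_{d'}\to\mathcal{M}_{d'}$, $$C_0^\infty(\mathcal{T}\otimes\mathcal{S}) = C_0^\infty(\mathcal{T})+C_0^\infty(\mathcal{S}),\qquad Q_0^\infty(\mathcal{T}\otimes\mathcal{S}) = Q_0^\infty(\mathcal{T})+Q_0^\infty(\mathcal{S}).$$
   Context: A quantum channel is a completely positive trace-preserving linear map. For a channel $\mathcal{T}:\mathcal{M}_d\to\mathcal{M}_d$, a channel $\mathcal{E}:\mathcal{M}_D\to\mathcal{M}_d$ is a $(D,\delta)$ classical code for $\mathcal{T}$ if there is a channel $\mathcal{R}:\mathcal{M}_d\to\mathcal{M}_D$ with $\frac1D\sum_{i=1}^D\langle i|\mathcal{R}\circ\mathcal{T}\circ\mathcal{E}(|i\rangle\langle i|)|i\rangle\ge 1-\delta$ for a fixed orthonormal basis $\{|i\rangle\}$ of $\mathbb{C}^D$; it is a $(D,\delta)$ quantum code if there is a channel $\mathcal{R}$ with $\langle\Phi^+|(\mathcal{I}\otimes(\mathcal{R}\circ\mathcal{T}\circ\mathcal{E}))(|\Phi^+\rangle\langle\Phi^+|)|\Phi^+\rangle\ge1-\delta$, where $|\Phi^+\rangle=\frac{1}{\sqrt D}\sum_{i=1}^D|i\rangle\otimes|i\rangle$. $C_\delta(\mathcal{T})=\sup\log D$ over $(D,\delta)$ classical codes, $Q_\delta(\mathcal{T})=\sup\log D$ over $(D,\delta)$ quantum codes, and $C^\infty_\delta(\mathcal{T})=\lim_{t\to\infty}C_\delta(\mathcal{T}^t)$,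 $Q^\infty_\delta(\mathcal{T})=\lim_{t\to\infty}Q_\delta(\mathcal{T}^t)$ with $\mathcal{T}^t$ the $t$-fold composition. $C_0^\infty, Q_0^\infty$ are the case $\delta=0$. *)

(* Defs.v *)
(* mathcomp + mathcomp-analysis (reals, ln, sup, limits)
   + mathcomp-real-closed (complex numbers R[i], Kronecker product tensmx). *)
From HB Require Import structures.
From mathcomp Require Import all_boot all_order all_algebra.
From mathcomp Require Import all_classical all_reals all_analysis.
From mathcomp Require Import complex mxtens.
Set Implicit Arguments. Unset Strict Implicit. Unset Printing Implicit Defensive.
Import Order.TTheory GRing.Theory Num.Theory numFieldNormedType.Exports.
Local Open Scope ring_scope.

Section QuantumDefs.
Context {R : realType}.
Local Notation C := R[i].

(* conjugate transpose A^dagger *)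
Definition adj {m n : nat} (A : 'M[C]_(m, n)) : 'M[C]_(n, m) :=
  map_mx (fun z => z^*) A^T.

(* positive semidefinite matrices (order on C: 0 <= z iff z is real and >= 0) *)
Definition psd {n : nat} (A : 'M[C]_n) : Prop :=
  adj A = A /\ forall v : 'cV[C]_n, 0 <= (adj v *m A *m v) 0 0.

(* C-linear maps M_m -> M_n *)
Definition linmap {m n : nat} (T : 'M[C]_m -> 'M[C]_n) : Prop :=
  forall (a : C) (X Y : 'M[C]_m), T (a *: X + Y) = a *: T X + T Y.

(* tensor product T (x) S of linear maps: the linear extension of
   A (x) B |-> T A (x) S B  (Kronecker product convention of tensmx) *)
Definition tensmap {m n p q : nat} (T : 'M[C]_m -> 'M[C]_n)
  (S : 'M[C]_p -> 'M[C]_q) (X : 'M[C]_(m * p)) : 'M[C]_(n * q) :=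
  \sum_(i1 < m) \sum_(j1 < m) \sum_(i2 < p) \sum_(j2 < p)
    X (mxtens_index (i1, i2)) (mxtens_index (j1, j2)) *:
      (T (delta_mx i1 j1) *t S (delta_mx i2 j2)).

(* completely positive: id_k (x) T is positive for every k *)
Definition compl_pos {m n : nat} (T : 'M[C]_m -> 'M[C]_n) : Prop :=
  forall (k : nat) (X : 'M[C]_(k * m)),
    psd X -> psd (tensmap (fun Y : 'M[C]_k => Y) T X).

Definition trace_pres {m n : nat} (T : 'M[C]_m -> 'M[C]_n) : Prop :=
  forall X : 'M[C]_m, \tr (T X) = \tr X.

(* quantum channel: completely positive trace-preserving linear map *)
Definition channel {m n : nat} (T : 'M[C]_m -> 'M[C]_n) : Prop :=
  linmap T /\ compl_pos T /\ trace_pres T.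

(* |i> and |i><i| *)
Definition ket {D : nat} (i : 'I_D) : 'cV[C]_D := delta_mx i 0.
Definition ketbra {D : nat} (i : 'I_D) : 'M[C]_D := ket i *m adj (ket i).

(* |Phi+> = D^{-1/2} sum_i |i> (x) |i> *)
Definition maxent (D : nat) : 'cV[C]_(D * D) :=
  (sqrtC (D%:R : C))^-1 *: \sum_(i < D) (ket i *t ket i).

Local Open Scope complex_scope.

(* (D, delta) classical code for T *)
Definition classical_code {d D : nat} (delta : R) (T : 'M[C]_d -> 'M[C]_d)
  (E : 'M[C]_D -> 'M[C]_d) : Prop :=
  channel E /\ exists Rc : 'M[C]_d -> 'M[C]_D, channel Rc /\
    (1 - delta)%:C <=
      (D%:R : C)^-1 * \sum_(i < D) (adj (ket i) *m Rc (T (E (ketbra i))) *m ket i) 0 0.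

(* (D, delta) quantum code for T *)
Definition quantum_code {d D : nat} (delta : R) (T : 'M[C]_d -> 'M[C]_d)
  (E : 'M[C]_D -> 'M[C]_d) : Prop :=
  channel E /\ exists Rc : 'M[C]_d -> 'M[C]_D, channel Rc /\
    (1 - delta)%:C <=
      (adj (maxent D) *m
         tensmap (fun Y : 'M[C]_D => Y) (fun X => Rc (T (E X)))
                 (maxent D *m adj (maxent D)) *m maxent D) 0 0.

Local Close Scope complex_scope.

Definition log2 (x : R) : R := ln x / ln 2.

(* C_delta(T) = sup log D over (D, delta) classical codes *)
Definition Ccap {d : nat} (delta : R) (T : 'M[C]_d -> 'M[C]_d) : R :=
  sup [set x : R | exists D : nat, (0 < D)%N /\ x = log2 D%:R /\
         exists E : 'M[C]_D -> 'M[C]_d, classical_code delta T E].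

(* Q_delta(T) = sup log D over (D, delta) quantum codes *)
Definition Qcap {d : nat} (delta : R) (T : 'M[C]_d -> 'M[C]_d) : R :=
  sup [set x : R | exists D : nat, (0 < D)%N /\ x = log2 D%:R /\
         exists E : 'M[C]_D -> 'M[C]_d, quantum_code delta T E].

(* t-fold composition T^t = iter t T, and the asymptotic quantities *)
Definition Cinf {d : nat} (delta : R) (T : 'M[C]_d -> 'M[C]_d) : R :=
  limn (fun t : nat => Ccap delta (iter t T)).

Definition Qinf {d : nat} (delta : R) (T : 'M[C]_d -> 'M[C]_d) : R :=
  limn (fun t : nat => Qcap delta (iter t T)).

End QuantumDefs.

(* Main.v *)
Require Import Defs.
From HB Require Import structures.
From mathcomp Require Import all_boot all_order all_algebra.
From mathcomp Require Import all_classical all_reals all_analysis.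
From mathcomp Require Import complex mxtens.
From mathcomp Require Import ring.
Import Order.TTheory GRing.Theory Num.Theory.
Local Open Scope ring_scope.
Set Implicit Arguments. Unset Strict Implicit. Unset Printing Implicit Defensive.

(** Fix a free ultrafilter and let A = lim T^t and W = lim_s lim_t T^(t - s).  Then W is an
    idempotent channel with W A = A, and W = T^u X_u with a channel X_u for every u, so
    T^u admits an error-free code of size D for all u iff W does.
    For an idempotent channel P with support projection s of P(1), compressing the dual of P to
    s gives an idempotent completely positive map Gamma whose fixed points form a
    *-algebra with unit s.  Let p_i be a maximal orthogonal family of minimal projections of
    this algebra.  Then P has a perfect classical code of size n = #{p_i} and a perfect
    quantum code of size k = max_i #{j : p_i Gamma(.) p_j <> 0}, and these are optimal because
    b <= sum_i w_i(b) 1 for b >= 0 in the algebra, where p_i b p_i = w_i(b) p_i, and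
    b |-> k sum_i p_i b p_i - b is completely positive on the algebra.  The data (p_i, Gamma)
    used in the upper bounds is stable under tensor products, hence so are n and k. *)

(** * Positive semidefinite matrices *)

(** The inequality >= only tensors codes. The content is <=, since a code for the product may be
    entangled across the two factors. Optimality is therefore certified by data whose conditions on
    matrices are compatible with linear combinations and need checking only on Kronecker products;
    the fixed-point algebra of the tensor channel is never analysed. No decomposition into matrix
    blocks is used either: in block terms n is the sum of the block sizes, k is the largest one, and
    p_i Gamma(.) p_j <> 0 says that p_i and p_j lie in the same block.

    The powers T^t need not converge, because the peripheral spectrum may rotate forever.
    Ultralimits exist without passing to subsequences, respect products, and can be taken along the
    same ultrafilter for both factors, so that tensor powers converge to the tensor product of the
    limits. A itself may still rotate its range; the shift by s in the second limit supplies the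
    missing inverse powers and makes W idempotent. *)

Section PositiveMatrices.
Context {R : realType}.
Local Notation C := R[i].

Lemma adjE m n (A : 'M[C]_(m, n)) i j : adj A i j = (A j i)^*.
Proof. by rewrite !mxE. Qed.

Lemma adjK m n (A : 'M[C]_(m, n)) : adj (adj A) = A.
Proof. by apply/matrixP=> i j; rewrite !adjE conjCK. Qed.

Lemma adjM m n p (A : 'M[C]_(m, n)) (B : 'M[C]_(n, p)) :
  adj (A *m B) = adj B *m adj A.
Proof. by rewrite /adj trmx_mul map_mxM. Qed.

Lemma adjD m n (A B : 'M[C]_(m, n)) : adj (A + B) = adj A + adj B.
Proof. by apply/matrixP=> i j; rewrite !mxE rmorphD. Qed.

Lemma adjZ m n (a : C) (A : 'M[C]_(m, n)) : adj (a *: A) = a^* *: adj A.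
Proof. by apply/matrixP=> i j; rewrite !mxE rmorphM. Qed.

Lemma adj0 m n : adj (0 : 'M[C]_(m, n)) = 0.
Proof. by apply/matrixP=> i j; rewrite !mxE conjC0. Qed.

Lemma adjN m n (A : 'M[C]_(m, n)) : adj (- A) = - adj A.
Proof. by apply/matrixP=> i j; rewrite !mxE rmorphN. Qed.

Lemma adjB m n (A B : 'M[C]_(m, n)) : adj (A - B) = adj A - adj B.
Proof. by rewrite adjD adjN. Qed.

Lemma adj1 n : adj (1%:M : 'M[C]_n) = 1%:M.
Proof. by apply/matrixP=> i j; rewrite !mxE conjC_nat eq_sym. Qed.

Lemma adj_sum m n (I : Type) (r : seq I) (P : pred I) (F : I -> 'M[C]_(m, n)) :
  adj (\sum_(i <- r | P i) F i) = \sum_(i <- r | P i) adj (F i).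
Proof. exact: (big_morph _ (@adjD m n) (adj0 m n)). Qed.

Lemma adj_delta m n i j : adj (delta_mx i j : 'M[C]_(m, n)) = delta_mx j i.
Proof. by apply/matrixP=> k l; rewrite !mxE conjC_nat andbC. Qed.

Lemma adj_tens m n p q (A : 'M[C]_(m, n)) (B : 'M[C]_(p, q)) :
  adj (A *t B) = adj A *t adj B.
Proof. by rewrite /adj trmx_tens map_mxT. Qed.

Lemma psd_form n (A : 'M[C]_n) (v : 'cV[C]_n) :
  psd A -> 0 <= (adj v *m A *m v) 0 0.
Proof. by case. Qed.

Lemma psd_adj n (A : 'M[C]_n) : psd A -> adj A = A.
Proof. by case. Qed.

Lemma dot_ge0 n (v : 'cV[C]_n) : 0 <= (adj v *m v) 0 0.
Proof. by rewrite mxE sumr_ge0 // => k _; rewrite adjE mulrC mul_conjC_ge0. Qed.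

Lemma psd_gram m n (B : 'M[C]_(m, n)) : psd (B *m adj B).
Proof.
split; first by rewrite adjM adjK.
move=> v; have -> : adj v *m (B *m adj B) *m v = adj (adj B *m v) *m (adj B *m v).
  by rewrite adjM adjK !mulmxA.
exact: dot_ge0.
Qed.

Lemma psd0 n : psd (0 : 'M[C]_n).
Proof. by split=> [|v]; rewrite ?adj0 // mulmx0 mul0mx mxE. Qed.

Lemma psdD n (A B : 'M[C]_n) : psd A -> psd B -> psd (A + B).
Proof.
move=> [hA pA] [hB pB]; split=> [|v]; first by rewrite adjD hA hB.
by rewrite mulmxDr mulmxDl mxE addr_ge0.
Qed.

Lemma psd_sum n (I : Type) (r : seq I) (P : pred I) (F : I -> 'M[C]_n) :
  (forall i, P i -> psd (F i)) -> psd (\sum_(i <- r | P i) F i).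
Proof. by move=> h; elim/big_ind: _ => [|A B|]; [exact: psd0 | exact: psdD | exact: h]. Qed.

Lemma psdZ n (a : C) (A : 'M[C]_n) : 0 <= a -> psd A -> psd (a *: A).
Proof.
move=> a0 [hA pA]; split=> [|v].
  by rewrite adjZ hA; congr (_ *: _); apply/conj_Creal/ger0_real.
by rewrite -scalemxAr -scalemxAl mxE mulr_ge0.
Qed.

Lemma psd_conj m n (B : 'M[C]_(m, n)) (A : 'M[C]_n) :
  psd A -> psd (B *m A *m adj B).
Proof.
move=> [hA pA]; split; first by rewrite !adjM adjK hA mulmxA.
move=> v.
suff -> : adj v *m (B *m A *m adj B) *m v = adj (adj B *m v) *m A *m (adj B *m v).
  exact: pA.
by rewrite adjM adjK !mulmxA.
Qed.

Lemma herm_spectral n (A : 'M[C]_n) : adj A = A ->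
  exists (U : 'M[C]_n) (l : 'rV[C]_n),
    [/\ U *m adj U = 1%:M, adj U *m U = 1%:M & A = adj U *m diag_mx l *m U].
Proof.
move=> hA.
have nA : A \is normalmx by apply/normalmxP; have : A *m adj A = adj A *m A by rewrite hA.
have /unitarymxP uP := spectral_unitarymx A.
have e : invmx (spectralmx A) = adj (spectralmx A).
  by rewrite invmx_unitary ?spectral_unitarymx.
exists (spectralmx A), (spectral_diag A); split => //.
  by apply: mulmx1C.
by move/orthomx_spectralP: nA; rewrite e.
Qed.

Lemma psd_spectral n (A : 'M[C]_n) : psd A ->
  exists (U : 'M[C]_n) (l : 'rV[C]_n),
    [/\ U *m adj U = 1%:M, adj U *m U = 1%:M, A = adj U *m diag_mx l *m U
      & forall i, 0 <= l 0 i].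
Proof.
move=> [hA pA]; have [U [l [h1 h2 e]]] := herm_spectral hA.
exists U, l; split => // i.
have := pA (adj U *m delta_mx i 0); rewrite e adjM adjK.
rewrite -!mulmxA (mulmxA U) h1 mul1mx (mulmxA U) h1 mul1mx adj_delta.
rewrite mulmxA -rowE -colE !mxE eqxx mulr1n.
by [].
Qed.

Lemma diag_mx_factor n (l : 'rV[C]_n) : (forall i, 0 <= l 0 i) ->
  exists D : 'M[C]_n, diag_mx l = D *m adj D.
Proof.
move=> h; pose r : 'rV[C]_n := \row_j sqrtC (l 0 j); exists (diag_mx r).
apply/matrixP=> i j; rewrite mul_diag_mx !mxE eq_sym.
case: eqP => [->|]; last by rewrite !mulr0n conjC0 mulr0.
rewrite !mulr1n conj_Creal ?ger0_real ?sqrtC_ge0 //.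
by rewrite -expr2 sqrtCK.
Qed.

Lemma psd_factor n (A : 'M[C]_n) : psd A -> exists B : 'M[C]_n, A = B *m adj B.
Proof.
move=> /psd_spectral [U [l [_ _ -> /diag_mx_factor [D ->]]]].
by exists (adj U *m D); rewrite adjM adjK !mulmxA.
Qed.

Lemma conj_diagM n (U : 'M[C]_n) (v w : 'rV[C]_n) : U *m adj U = 1%:M ->
  (adj U *m diag_mx v *m U) *m (adj U *m diag_mx w *m U) =
  adj U *m diag_mx (\row_j (v 0 j * w 0 j)) *m U.
Proof.
move=> h; rewrite -!mulmxA (mulmxA U) h mul1mx; congr (_ *m _).
rewrite mulmxA; congr (_ *m _); apply/matrixP=> i j.
by rewrite mul_diag_mx !mxE mulrnAr.
Qed.

Lemma adj_conj_diag_bool n (U : 'M[C]_n) (b : 'I_n -> bool) :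
  adj (adj U *m diag_mx (\row_j (b j)%:R) *m U) =
  adj U *m diag_mx (\row_j (b j)%:R) *m U.
Proof.
rewrite !adjM adjK !mulmxA; congr (_ *m _ *m _).
apply/matrixP=> i j; rewrite !mxE [j == i]eq_sym.
by case: (i =P j) => [->|_]; rewrite ?mulr1n ?mulr0n ?conjC_nat ?conjC0.
Qed.

Lemma gram_trace m n (B : 'M[C]_(m, n)) :
  \tr (B *m adj B) = \sum_i \sum_j `|B i j| ^+ 2.
Proof.
apply: eq_bigr => i _; rewrite mxE; apply: eq_bigr => j _.
by rewrite adjE normCK.
Qed.

Lemma gram_trace_ge0 m n (B : 'M[C]_(m, n)) : 0 <= \tr (B *m adj B).
Proof.
rewrite gram_trace; apply: sumr_ge0 => i _; apply: sumr_ge0 => j _.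
by rewrite exprn_ge0.
Qed.

Lemma gram_trace_eq0 m n (B : 'M[C]_(m, n)) : \tr (B *m adj B) = 0 -> B = 0.
Proof.
rewrite gram_trace => h; apply/matrixP=> i j; rewrite mxE.
have ge k : 0 <= \sum_l `|B k l| ^+ 2.
  by apply: sumr_ge0 => l _; rewrite exprn_ge0.
have /(_ i isT) h1 := psumr_eq0P (fun k _ => ge k) h.
have /(_ j isT) h2 := psumr_eq0P (fun l _ => exprn_ge0 2 (normr_ge0 (B i l))) h1.
by move/eqP: h2; rewrite expf_eq0 normr_eq0 => /eqP.
Qed.

Lemma psd_tr_ge0 n (A : 'M[C]_n) : psd A -> 0 <= \tr A.
Proof. by move=> /psd_factor [B ->]; apply: gram_trace_ge0. Qed.

Lemma psd_tr_eq0 n (A : 'M[C]_n) : psd A -> \tr A = 0 -> A = 0.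
Proof.
by move=> /psd_factor [B ->] /gram_trace_eq0 ->; rewrite mul0mx.
Qed.

Lemma psd_trM_ge0 n (A B : 'M[C]_n) : psd A -> psd B -> 0 <= \tr (A *m B).
Proof.
move=> pA /psd_factor [D ->]; rewrite mulmxA mxtrace_mulC mulmxA.
by apply: psd_tr_ge0; rewrite -{2}(adjK D); apply: psd_conj.
Qed.

(** With [A = D *m adj D] and [B = E *m adj E] the trace is the squared Frobenius norm of
    [adj D *m E]. *)
Lemma psd_trM_eq0 n (A B : 'M[C]_n) : psd A -> psd B ->
  \tr (A *m B) = 0 -> A *m B = 0.
Proof.
move=> /psd_factor [D ->] /psd_factor [E ->] h.
have /gram_trace_eq0 z : \tr (adj D *m E *m adj (adj D *m E)) = 0.
  by rewrite -h adjM adjK -[RHS]mxtrace_mulC !mulmxA mxtrace_mulC !mulmxA.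
by rewrite -mulmxA (mulmxA (adj D)) z mul0mx mulmx0.
Qed.

Lemma psd1 n : psd (1%:M : 'M[C]_n).
Proof. by have := psd_gram (1%:M : 'M[C]_n); rewrite adj1 mulmx1. Qed.

Lemma psd_le_trace n (A : 'M[C]_n) : psd A -> psd ((\tr A)%:M - A).
Proof.
move=> /psd_spectral [U [l [h1 h2 -> l0]]].
have -> : \tr (adj U *m diag_mx l *m U) = \sum_i l 0 i.
  by rewrite mxtrace_mulC mulmxA h1 mul1mx mxtrace_diag.
have -> : (\sum_i l 0 i)%:M - adj U *m diag_mx l *m U =
    adj U *m diag_mx (\row_j (\sum_i l 0 i - l 0 j)) *m adj (adj U).
  have -> : diag_mx (\row_j (\sum_i l 0 i - l 0 j)) = (\sum_i l 0 i)%:M - diag_mx l.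
    by apply/matrixP=> i j; rewrite !mxE; case: eqP => [->|]; rewrite ?mulr1n ?mulr0n ?subr0.
  by rewrite adjK mulmxBr mulmxBl mul_mx_scalar -scalemxAl h2 scalemx1.
apply: psd_conj; have [j|D ->] := @diag_mx_factor _ (\row_j (\sum_i l 0 i - l 0 j)); last exact: psd_gram.
rewrite mxE (bigD1 j) //= [X in X - _]addrC addrK.
exact: sumr_ge0.
Qed.

Lemma psd_trM_le n (A B : 'M[C]_n) : psd A -> psd B ->
  \tr (A *m B) <= \tr A * \tr B.
Proof.
move=> /psd_le_trace pA pB; have := psd_trM_ge0 pA pB.
by rewrite mulmxBl mxtraceD linearN /= mul_scalar_mx mxtraceZ subr_ge0.
Qed.

End PositiveMatrices.

(** * Kraus representations *)

Section Kraus.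
Context {R : realType}.
Local Notation C := R[i].

(** * Kronecker products *)

Lemma tensmxDl m n p q (A A' : 'M[C]_(m, n)) (B : 'M[C]_(p, q)) :
  (A + A') *t B = A *t B + A' *t B.
Proof. by apply/matrixP=> i j; rewrite !mxE mulrDl. Qed.

Lemma tensmxDr m n p q (A : 'M[C]_(m, n)) (B B' : 'M[C]_(p, q)) :
  A *t (B + B') = A *t B + A *t B'.
Proof. by apply/matrixP=> i j; rewrite !mxE mulrDr. Qed.

Lemma tensmxZl m n p q a (A : 'M[C]_(m, n)) (B : 'M[C]_(p, q)) :
  (a *: A) *t B = a *: (A *t B).
Proof. by apply/matrixP=> i j; rewrite !mxE mulrA. Qed.

Lemma tensmxZr m n p q a (A : 'M[C]_(m, n)) (B : 'M[C]_(p, q)) :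
  A *t (a *: B) = a *: (A *t B).
Proof. by apply/matrixP=> i j; rewrite !mxE mulrCA. Qed.

Lemma tensmx_suml m n p q (I : Type) (r : seq I) (P : pred I)
    (F : I -> 'M[C]_(m, n)) (B : 'M[C]_(p, q)) :
  (\sum_(i <- r | P i) F i) *t B = \sum_(i <- r | P i) F i *t B.
Proof.
by apply: (big_morph (fun X => X *t B)) => [X Y|]; rewrite ?tensmxDl ?tens0mx.
Qed.

Lemma tensmx_sumr m n p q (I : Type) (r : seq I) (P : pred I)
    (F : I -> 'M[C]_(p, q)) (A : 'M[C]_(m, n)) :
  A *t (\sum_(i <- r | P i) F i) = \sum_(i <- r | P i) A *t F i.
Proof.
by apply: (big_morph (fun X => A *t X)) => [X Y|]; rewrite ?tensmxDr ?tensmx0.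
Qed.

Lemma tensmx11 m n : (1%:M : 'M[C]_m) *t (1%:M : 'M[C]_n) = 1%:M.
Proof.
apply/matrixP=> i j; case: (mxtens_indexP i)=> i1 i2; case: (mxtens_indexP j)=> j1 j2.
by rewrite tensmxE !mxE (can_eq (@mxtens_indexK _ _)) xpair_eqE -natrM mulnb.
Qed.

Lemma tens_delta m n p q i1 j1 i2 j2 :
  (delta_mx i1 j1 : 'M[C]_(m, n)) *t (delta_mx i2 j2 : 'M[C]_(p, q)) =
  delta_mx (mxtens_index (i1, i2)) (mxtens_index (j1, j2)).
Proof.
apply/matrixP=> i j; case: (mxtens_indexP i)=> k1 k2; case: (mxtens_indexP j)=> l1 l2.
rewrite tensmxE !mxE !(can_eq (@mxtens_indexK _ _)) !xpair_eqE -natrM mulnb.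
by congr (nat_of_bool _)%:R; rewrite andbACA.
Qed.

Lemma big_mxtens_index (V : nmodType) m n (F : 'I_(m * n) -> V) :
  \sum_k F k = \sum_i \sum_j F (mxtens_index (i, j)).
Proof.
rewrite pair_big (reindex (@mxtens_index m n)) /=; first by apply: eq_bigr => -[].
by exists (@mxtens_unindex m n)=> k _; rewrite (mxtens_indexK, mxtens_unindexK).
Qed.

Lemma mxtrace_tens m n (A : 'M[C]_m) (B : 'M[C]_n) :
  \tr (A *t B) = \tr A * \tr B.
Proof.
rewrite /mxtrace big_mxtens_index mulr_suml; apply: eq_bigr => i _.
by rewrite mulr_sumr; apply: eq_bigr => j _; rewrite tensmxE.
Qed.

(** Kronecker products span. Stating this as an induction principle also covers existential
    properties, such as being a multiple of a given matrix. *)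
Lemma tensmx_ind m n p q (Q : 'M[C]_(m * p, n * q) -> Prop) :
  (forall X Y, Q X -> Q Y -> Q (X + Y)) -> (forall a X, Q X -> Q (a *: X)) ->
  (forall A B, Q (A *t B)) -> forall X, Q X.
Proof.
move=> QD QZ QT X; rewrite (matrix_sum_delta X).
have Q0 : Q 0 by rewrite -(tens0mx 0); apply: QT.
elim/big_ind: _ => // i _; elim/big_ind: _ => // j _; apply: QZ.
case: (mxtens_indexP i)=> k1 k2; case: (mxtens_indexP j)=> l1 l2.
by rewrite -tens_delta.
Qed.

(** * Linear maps and their tensor products *)

Section Linmap.
Variables (m n : nat) (T : 'M[C]_m -> 'M[C]_n).
Hypothesis hT : linmap T.

Lemma linmapD X Y : T (X + Y) = T X + T Y.
Proof. by have := hT 1 X Y; rewrite !scale1r. Qed.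

Lemma linmap0 : T 0 = 0.
Proof. by apply: (addrI (T 0)); rewrite -linmapD !addr0. Qed.

Lemma linmapZ a X : T (a *: X) = a *: T X.
Proof. by have := hT a X 0; rewrite linmap0 !addr0. Qed.

Lemma linmap_sum (I : Type) (r : seq I) (P : pred I) (F : I -> 'M[C]_m) :
  T (\sum_(i <- r | P i) F i) = \sum_(i <- r | P i) T (F i).
Proof. exact: (big_morph _ linmapD linmap0). Qed.

Lemma linmap_delta X : T X = \sum_i \sum_j X i j *: T (delta_mx i j).
Proof.
rewrite {1}(matrix_sum_delta X) linmap_sum; apply: eq_bigr => i _.
by rewrite linmap_sum; apply: eq_bigr => j _; rewrite linmapZ.
Qed.
End Linmap.

Lemma linmap_comp m n p (T : 'M[C]_m -> 'M[C]_n) (S : 'M[C]_n -> 'M[C]_p) :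
  linmap T -> linmap S -> linmap (fun X => S (T X)).
Proof. by move=> hT hS a X Y; rewrite hT hS. Qed.

Lemma linmap_tens_ext m p n (F G : 'M[C]_(m * p) -> 'M[C]_n) :
  linmap F -> linmap G -> (forall A B, F (A *t B) = G (A *t B)) -> F =1 G.
Proof.
move=> hF hG h X; elim/tensmx_ind: X => // [X Y|a X] e; last first.
  by rewrite (linmapZ hF) (linmapZ hG) e.
by rewrite (linmapD hF) (linmapD hG) e => ->.
Qed.

Lemma linmap_tensmap m n p q (T : 'M[C]_m -> 'M[C]_n) (S : 'M[C]_p -> 'M[C]_q) :
  linmap (tensmap T S).
Proof.
move=> a X Y; rewrite /tensmap.
do 4! [rewrite scaler_sumr -big_split /=; apply: eq_bigr => ? _].
by rewrite !mxE scalerDl scalerA.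
Qed.

Lemma tensmap_tens m n p q (T : 'M[C]_m -> 'M[C]_n) (S : 'M[C]_p -> 'M[C]_q) A B :
  linmap T -> linmap S -> tensmap T S (A *t B) = T A *t S B.
Proof.
move=> hT hS; rewrite (linmap_delta hT) (linmap_delta hS) /tensmap.
do 2! [rewrite tensmx_suml; apply: eq_bigr => ? _].
do 2! [rewrite tensmx_sumr; apply: eq_bigr => ? _].
by rewrite tensmxZl tensmxZr scalerA tensmxE.
Qed.

Lemma tensmap_uniq m n p q (T : 'M[C]_m -> 'M[C]_n) (S : 'M[C]_p -> 'M[C]_q)
    (F : 'M[C]_(m * p) -> 'M[C]_(n * q)) :
  linmap T -> linmap S -> linmap F ->
  (forall A B, F (A *t B) = T A *t S B) -> F =1 tensmap T S.
Proof.
move=> hT hS hF h; apply: linmap_tens_ext => // [|A B]; first exact: linmap_tensmap.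
by rewrite tensmap_tens.
Qed.

Lemma tensmap_comp m n p m' n' p' (T : 'M[C]_m -> 'M[C]_n) (S : 'M[C]_n -> 'M[C]_p)
    (T' : 'M[C]_m' -> 'M[C]_n') (S' : 'M[C]_n' -> 'M[C]_p') X :
  linmap T -> linmap S -> linmap T' -> linmap S' ->
  tensmap S S' (tensmap T T' X) = tensmap (fun X => S (T X)) (fun X => S' (T' X)) X.
Proof.
move=> hT hS hT' hS'.
apply: (@tensmap_uniq _ _ _ _ _ _ (fun X => tensmap S S' (tensmap T T' X))).
- exact: linmap_comp.
- exact: linmap_comp.
- by apply: linmap_comp; apply: linmap_tensmap.
by move=> A B; rewrite !tensmap_tens.
Qed.

(** Lists instead of indexed families: composition and tensor product become lists of all pairs, and
    completing a partial channel becomes concatenation. *)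
Definition kraus m n (Ks : seq 'M[C]_(n, m)) (X : 'M[C]_m) : 'M[C]_n :=
  \sum_(K <- Ks) K *m X *m adj K.

Definition adjs m n (Ks : seq 'M[C]_(m, n)) := [seq adj K | K <- Ks].

Lemma linmap_kraus m n (Ks : seq 'M[C]_(n, m)) : linmap (kraus Ks).
Proof.
move=> a X Y; rewrite /kraus scaler_sumr -big_split; apply: eq_bigr => K _ /=.
by rewrite mulmxDr mulmxDl -scalemxAr -scalemxAl.
Qed.

Lemma kraus_adjs m n (Ks : seq 'M[C]_(m, n)) X :
  kraus (adjs Ks) X = \sum_(K <- Ks) adj K *m X *m K.
Proof. by rewrite /kraus big_map; apply: eq_bigr => K _; rewrite adjK. Qed.

Lemma adj_kraus m n (Ks : seq 'M[C]_(n, m)) X : adj (kraus Ks X) = kraus Ks (adj X).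
Proof.
by rewrite adj_sum; apply: eq_bigr => K _; rewrite !adjM adjK mulmxA.
Qed.

Lemma psd_kraus m n (Ks : seq 'M[C]_(n, m)) X : psd X -> psd (kraus Ks X).
Proof. by move=> h; apply: psd_sum => K _; apply: psd_conj. Qed.

Lemma kraus_dual m n (Ks : seq 'M[C]_(n, m)) X Y :
  \tr (Y *m kraus Ks X) = \tr (kraus (adjs Ks) Y *m X).
Proof.
rewrite kraus_adjs mulmx_sumr mulmx_suml !raddf_sum; apply: eq_bigr => K _ /=.
by rewrite !mulmxA mxtrace_mulC !mulmxA.
Qed.

Lemma kraus_comp m n p (Ks : seq 'M[C]_(n, m)) (Ls : seq 'M[C]_(p, n)) X :
  kraus Ls (kraus Ks X) = kraus [seq L *m K | L <- Ls, K <- Ks] X.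
Proof.
rewrite /kraus big_allpairs_dep; apply: eq_bigr => L _.
by rewrite mulmx_sumr mulmx_suml; apply: eq_bigr => K _; rewrite adjM !mulmxA.
Qed.

Lemma kraus_tens m n p q (Ks : seq 'M[C]_(n, m)) (Ls : seq 'M[C]_(q, p)) :
  kraus [seq K *t L | K <- Ks, L <- Ls] =1 tensmap (kraus Ks) (kraus Ls).
Proof.
apply: tensmap_uniq; do ?exact: linmap_kraus.
move=> A B; rewrite /kraus big_allpairs_dep tensmx_suml; apply: eq_bigr => K _.
by rewrite tensmx_sumr; apply: eq_bigr => L _; rewrite adj_tens !tensmx_mul.
Qed.

Lemma kraus1 m : kraus [:: 1%:M] =1 (id : 'M[C]_m -> 'M[C]_m).
Proof. by move=> X; rewrite /kraus big_seq1 adj1 mul1mx mulmx1. Qed.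

Lemma eq_tensmap m n p q (T T' : 'M[C]_m -> 'M[C]_n) (S S' : 'M[C]_p -> 'M[C]_q) :
  T =1 T' -> S =1 S' -> tensmap T S =1 tensmap T' S'.
Proof. by move=> /funext -> /funext ->. Qed.

Lemma mulmx_delta_entry m n p q (A : 'M[C]_(m, n)) i j (B : 'M[C]_(p, q)) k l :
  (A *m delta_mx i j *m B) k l = A k i * B j l.
Proof.
rewrite mxE (bigD1 j) //= big1 ?addr0 => [|j' /negbTE nj].
  rewrite mxE (bigD1 i) //= big1 ?addr0 => [|i' /negbTE ni].
    by rewrite mxE !eqxx mulr1.
  by rewrite mxE ni mulr0.
rewrite mxE big1 ?mul0r // => i' _.
by rewrite mxE nj andbF mulr0.
Qed.

Lemma mulmx_delta2 m n p q (a : 'I_m) (k : 'I_n) (W : 'M[C]_(n, p)) (l : 'I_p) (b : 'I_q) :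
  delta_mx a k *m W *m delta_mx l b = W k l *: delta_mx a b.
Proof.
rewrite -(mul_delta_mx (0 : 'I_1) a k) -(mul_delta_mx (0 : 'I_1) l b).
have e : delta_mx 0 k *m W *m delta_mx l 0 = ((W k l)%:M : 'M[C]_1).
  by rewrite [LHS]mx11_scalar -rowE -colE !mxE.
rewrite !mulmxA -2!(mulmxA (delta_mx a 0)) e mul_mx_scalar -scalemxAl.
by rewrite mul_delta_mx.
Qed.

Lemma mxtrace_mul_delta m n (A : 'M[C]_(m, n)) i j : \tr (A *m delta_mx j i) = A i j.
Proof.
rewrite /mxtrace (bigD1 i) //= big1 ?addr0 => [|k /negbTE nk]; last first.
  by rewrite mxE big1 // => l _; rewrite mxE nk andbF mulr0.
rewrite mxE (bigD1 j) //= big1 ?addr0 => [|l /negbTE nl]; rewrite mxE ?nl ?mulr0 //.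
by rewrite !eqxx mulr1.
Qed.

Lemma mxtrace_delta n (i : 'I_n) : \tr (delta_mx i i : 'M[C]_n) = 1.
Proof. by rewrite -[delta_mx i i]mul1mx mxtrace_mul_delta mxE eqxx. Qed.

Lemma mxtrace_inj m n (A B : 'M[C]_(m, n)) :
  (forall X, \tr (A *m X) = \tr (B *m X)) -> A = B.
Proof.
by move=> h; apply/matrixP=> i j; rewrite -2!mxtrace_mul_delta h.
Qed.

Lemma kraus_tp m n (Ks : seq 'M[C]_(n, m)) :
  trace_pres (kraus Ks) <-> kraus (adjs Ks) 1%:M = 1%:M.
Proof.
split=> [h|h X]; last by rewrite -[kraus Ks X]mul1mx kraus_dual h mul1mx.
by apply: mxtrace_inj => X; rewrite -kraus_dual !mul1mx h.
Qed.

Lemma channel_kraus m n (Ks : seq 'M[C]_(n, m)) :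
  kraus (adjs Ks) 1%:M = 1%:M -> channel (kraus Ks).
Proof.
move=> h; split; first exact: linmap_kraus.
split; last exact/kraus_tp.
move=> k X /psd_kraus pX.
have -> : tensmap (fun Y : 'M[C]_k => Y) (kraus Ks) X =
    kraus [seq K *t L | K <- [:: 1%:M], L <- Ks] X.
  by rewrite kraus_tens; apply: eq_tensmap => // Y; rewrite kraus1.
exact: pX.
Qed.

Lemma choi_entry m n (T : 'M[C]_m -> 'M[C]_n) i j k l : linmap T ->
  tensmap (fun Y : 'M[C]_m => Y) T (\sum_i \sum_j delta_mx i j *t delta_mx i j)
    (mxtens_index (i, k)) (mxtens_index (j, l)) = T (delta_mx i j) k l.
Proof.
move=> hT; have lid : linmap (fun Y : 'M[C]_m => Y) by move=> a X Y.
have lT := linmap_tensmap (fun Y : 'M[C]_m => Y) T.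
rewrite (linmap_sum lT) summxE (bigD1 i) //=.
rewrite [X in _ + X]big1 ?addr0 => [|i' /negbTE ni]; last first.
  rewrite (linmap_sum lT) summxE big1 // => j' _.
  by rewrite tensmap_tens // tensmxE mxE eq_sym ni mul0r.
rewrite (linmap_sum lT) summxE (bigD1 j) //=.
rewrite big1 ?addr0 => [|j' /negbTE nj]; rewrite tensmap_tens // tensmxE mxE.
  by rewrite !eqxx mul1r.
by rewrite [j == _]eq_sym nj andbF mul0r.
Qed.

(** The columns of a factor [B] of the Choi matrix, reshaped, are the Kraus operators. The length is
    recorded because it makes [channel_entry_bound] uniform over all channels between the same
    spaces. *)
Lemma choi_kraus m n (T : 'M[C]_m -> 'M[C]_n) : linmap T -> compl_pos T ->
  exists Ks : seq 'M[C]_(n, m), size Ks = (m * n)%N /\ T =1 kraus Ks.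
Proof.
move=> hT cT.
pose X0 : 'M[C]_(m * m) := \sum_i \sum_j delta_mx i j *t delta_mx i j.
have pX0 : psd X0.
  (* The unnormalised maximally entangled vector; [1 * 1] is the width that [*t] gives to two
     columns. *)
  pose W : 'M[C]_(m * m, 1 * 1) := \sum_i delta_mx i 0 *t delta_mx i 0.
  suff -> : X0 = W *m adj W by apply: psd_gram.
  rewrite /W mulmx_suml; apply: eq_bigr => i _.
  rewrite adj_sum mulmx_sumr; apply: eq_bigr => j _.
  by rewrite adj_tens !adj_delta tensmx_mul !mul_delta_mx.
have /psd_factor [B eB] := cT m X0 pX0.
pose K c : 'M[C]_(n, m) := \matrix_(k, i) B (mxtens_index (i, k)) c.
exists [seq K c | c <- enum 'I_(m * n)]; split; first by rewrite size_map size_enum_ord.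
move=> X; rewrite (linmap_delta hT) (linmap_delta (linmap_kraus _) X).
apply: eq_bigr => i _; apply: eq_bigr => j _; congr (_ *: _).
rewrite /kraus big_map big_enum /=.
apply/matrixP=> k l.
rewrite -(choi_entry i j k l hT) -/X0; move: eB => ->.
rewrite mxE summxE; apply: eq_bigr => c _.
by rewrite mulmx_delta_entry adjE !mxE.
Qed.

Lemma kraus_channel m n (T : 'M[C]_m -> 'M[C]_n) : channel T ->
  exists Ks : seq 'M[C]_(n, m),
    [/\ size Ks = (m * n)%N, T =1 kraus Ks & kraus (adjs Ks) 1%:M = 1%:M].
Proof.
move=> [hT [cT tT]]; have [Ks [sK eK]] := choi_kraus hT cT; exists Ks; split => //.
by apply/kraus_tp => X; rewrite -eK.
Qed.

(** * Closure properties of channels *)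

Lemma channel_ext m n (T S : 'M[C]_m -> 'M[C]_n) : T =1 S -> channel T -> channel S.
Proof. by move=> /funext ->. Qed.

Lemma channel_id m : channel (fun X : 'M[C]_m => X).
Proof.
apply: channel_ext (kraus1 (m:=m)) _; apply: channel_kraus.
by rewrite kraus_adjs big_seq1 adj1 !mul1mx.
Qed.

Lemma channel_comp m n p (T : 'M[C]_m -> 'M[C]_n) (S : 'M[C]_n -> 'M[C]_p) :
  channel T -> channel S -> channel (fun X => S (T X)).
Proof.
move=> /kraus_channel [Ks [_ /funext -> hK]] /kraus_channel [Ls [_ /funext -> hL]].
apply: channel_ext (fun X => esym (kraus_comp Ks Ls X)) _; apply: channel_kraus.
transitivity (kraus (adjs Ks) (kraus (adjs Ls) 1%:M)); last by rewrite hL.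
rewrite !kraus_adjs big_allpairs_dep exchange_big.
apply: eq_bigr => K _ /=; rewrite mulmx_sumr mulmx_suml; apply: eq_bigr => L _.
by rewrite adjM !mulmx1 !mulmxA.
Qed.

Lemma channel_tens m n p q (T : 'M[C]_m -> 'M[C]_n) (S : 'M[C]_p -> 'M[C]_q) :
  channel T -> channel S -> channel (tensmap T S).
Proof.
move=> /kraus_channel [Ks [_ /funext -> hK]] /kraus_channel [Ls [_ /funext -> hL]].
apply: channel_ext (kraus_tens Ks Ls) _; apply: channel_kraus.
transitivity (kraus (adjs Ks) 1%:M *t kraus (adjs Ls) 1%:M); last first.
  by rewrite hK hL tensmx11.
rewrite !kraus_adjs big_allpairs_dep tensmx_suml.
apply: eq_bigr => K _; rewrite tensmx_sumr; apply: eq_bigr => L _.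
by rewrite adj_tens !mulmx1 tensmx_mul.
Qed.

Lemma channel_iter m (T : 'M[C]_m -> 'M[C]_m) t : channel T -> channel (iter t T).
Proof.
by move=> h; elim: t => [|t IH]; [exact: channel_id | exact: channel_comp IH h].
Qed.

Lemma tensmap_id m p : tensmap (fun X : 'M[C]_m => X) (fun Y : 'M[C]_p => Y) =1 id.
Proof. by move=> X; rewrite -(@tensmap_uniq _ _ _ _ _ _ id). Qed.

Lemma tensmap_iter m p (T : 'M[C]_m -> 'M[C]_m) (S : 'M[C]_p -> 'M[C]_p) t :
  channel T -> channel S -> iter t (tensmap T S) =1 tensmap (iter t T) (iter t S).
Proof.
move=> hT hS; elim: t => [|t IH] X /=; first by rewrite tensmap_id.
by rewrite IH tensmap_comp //; [case: (channel_iter t hT) | case: hT | case: (channel_iter t hS) | case: hS].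
Qed.

End Kraus.

(** * The algebra of an idempotent channel *)

Section Idempotent.
Context {R : realType}.
Local Notation C := R[i].

(** [t] is the pseudo-inverse of [A], with [0^-1 = 0] on the kernel; [s = t *m A] allows [A] to be
    cancelled on the left up to its support. *)
Lemma psd_support n (A : 'M[C]_n) : psd A ->
  exists s t : 'M[C]_n, [/\ adj s = s, s *m s = s, s *m A = A, A *m s = A & s = t *m A].
Proof.
move=> /psd_spectral [U [l [h1 h2 -> l0]]].
pose conjU (v : 'rV[C]_n) := adj U *m diag_mx v *m U.
have cM v w : conjU v *m conjU w = conjU (\row_j (v 0 j * w 0 j)) by exact: conj_diagM.
exists (conjU (\row_j (l 0 j != 0)%:R)), (conjU (\row_j (l 0 j)^-1)).
rewrite -/(conjU l) !cM; split.
- exact: adj_conj_diag_bool.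
all: congr conjU; apply/rowP=> j; rewrite !mxE.
- by case: eqP; rewrite ?mul0r ?mul1r.
- by case: eqP => [->|]; rewrite ?mul0r ?mul1r.
- by case: eqP => [->|]; rewrite ?mul0r ?mulr1.
- by case: eqP => [->|/eqP n0]; rewrite ?mulr0 ?mulVf.
Qed.

Lemma gram_sum_eq0 m n (I : eqType) (r : seq I) (F : I -> 'M[C]_(m, n)) :
  \tr (\sum_(i <- r) F i *m adj (F i)) = 0 -> {in r, forall i, F i = 0}.
Proof.
rewrite raddf_sum /= => /eqP; rewrite psumr_eq0 => [|i _]; last exact: gram_trace_ge0.
by move=> /allP h i /h /eqP /gram_trace_eq0.
Qed.

(** The fixed points of the dual Phi of [P] need not be closed under products, for lack of a
    faithful invariant state; compressing to the support of [P 1] restores one. [Gs] represents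
    Gamma = s Phi(.) s, and the last clause is trace duality on the corner of s. *)
Lemma idempotent_algebra d (P : 'M[C]_d -> 'M[C]_d) :
  (0 < d)%N -> channel P -> (forall X, P (P X) = P X) ->
  exists (s : 'M[C]_d) (Gs : seq 'M[C]_d),
  [/\ adj s = s /\ s *m s = s,
      kraus Gs 1%:M = s /\ (forall X, s *m kraus Gs X *m s = kraus Gs X),
      (forall X, kraus Gs (kraus Gs X) = kraus Gs X),
      (forall x y, kraus Gs x = x -> kraus Gs y = y -> kraus Gs (x *m y) = x *m y) &
      s != 0 /\ (forall Y, s *m P Y *m s = P Y) /\
      (forall X Y, s *m Y *m s = Y -> \tr (X *m P Y) = \tr (kraus Gs X *m Y))].
Proof.
move=> d0 chP PP; have [Ks [_ /funext eP tp]] := kraus_channel chP.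
have [_ [_ trP]] := chP.
pose sg := P 1%:M.
have psg : psd sg by rewrite /sg eP; apply/psd_kraus/psd1.
have [s [t [hs ss sA As eS]]] := psd_support psg.
(* (1 - s) sg (1 - s) = 0 is the sum of the squares of the (1 - s) K, so every K has its range
   inside s. *)
have sK : {in Ks, forall K, s *m K = K}.
  move=> K KKs; apply/esym/eqP; rewrite -subr_eq0 -{1}(mul1mx K) -mulmxBl; apply/eqP.
  move: K KKs; apply: gram_sum_eq0.
  transitivity (\tr ((1%:M - s) *m sg *m adj (1%:M - s))).
    rewrite /sg eP /kraus mulmx_sumr mulmx_suml; congr (\tr _); apply: eq_bigr => K _.
    by rewrite adjM !mulmxA mulmx1.
  by rewrite mulmxBl mul1mx sA subrr mul0mx linear0.
have Ks_s : {in Ks, forall K, adj K *m s = adj K}.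
  by move=> K KKs; have /(congr1 adj) := sK K KKs; rewrite adjM hs.
pose Gs := [seq s *m adj K | K <- Ks].
have eG X : kraus Gs X = s *m kraus (adjs Ks) X *m s.
  rewrite kraus_adjs /kraus big_map mulmx_sumr mulmx_suml; apply: eq_bigr => K _.
  by rewrite adjM adjK hs !mulmxA.
have Ps Y : s *m P Y *m s = P Y.
  rewrite eP /kraus mulmx_sumr mulmx_suml; apply: eq_big_seq => K KKs.
  by rewrite !mulmxA (sK K) // -!mulmxA Ks_s.
(* Phi sees only the corner of s, which is why the compression stays idempotent. *)
have Phi_s X : kraus (adjs Ks) (s *m X *m s) = kraus (adjs Ks) X.
  rewrite !kraus_adjs; apply: eq_big_seq => K KKs.
  by rewrite -!mulmxA (sK K) // !mulmxA Ks_s.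
have PhiPhi X : kraus (adjs Ks) (kraus (adjs Ks) X) = kraus (adjs Ks) X.
  by apply: mxtrace_inj => Y; rewrite -!kraus_dual -eP PP.
have G1 : kraus Gs 1%:M = s by rewrite eG tp mulmx1 ss.
have Gss X : s *m kraus Gs X *m s = kraus Gs X.
  by rewrite eG !mulmxA ss -!mulmxA ss.
(* Closure under products follows: in the sum of the G x y (adj G) the factor y can be moved past
   adj G. *)
have comm x : kraus Gs x = x -> {in Gs, forall G, x *m adj G = adj G *m x}.
  move=> Gx.
  have hx : kraus Gs (adj x) = adj x by rewrite -adj_kraus Gx.
  have sx : s *m x = x by rewrite -Gx -Gss !mulmxA ss.
  have sx' : s *m adj x = adj x by rewrite -hx -Gss !mulmxA ss.
  (* Schwarz: the remainder is a sum of squares M G * (M G)^*, killed by the faithful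
     state sg, so every M G vanishes. *)
  pose M G := adj (x *m adj G - adj G *m x).
  have eM : \sum_(G <- Gs) M G *m adj (M G) = kraus Gs (adj x *m x) - adj x *m x.
    transitivity (kraus Gs (adj x *m x) - kraus Gs (adj x) *m x
                  - adj x *m kraus Gs x + adj x *m kraus Gs 1%:M *m x).
      rewrite /kraus mulmx_suml !mulmx_sumr mulmx_suml -!sumrB -big_split /=.
      apply: eq_bigr => G _; rewrite /M adjK adjB !adjM adjK mulmxBl !mulmxBr !mulmxA mulmx1.
      by rewrite opprB !addrA addrAC.
    by rewrite G1 Gx hx -mulmxA sx subrK.
  have p : psd (\sum_(G <- Gs) M G *m adj (M G)) by apply: psd_sum => G _; apply: psd_gram.
  (* [sg] is Gamma-invariant because P sg = sg. *)
  have trG w : \tr (sg *m kraus Gs w) = \tr (sg *m w).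
    rewrite eG !mulmxA As mxtrace_mulC mulmxA sA mxtrace_mulC -kraus_dual -eP /sg PP.
    by rewrite mxtrace_mulC.
  have t0 : \tr (sg *m (\sum_(G <- Gs) M G *m adj (M G))) = 0.
    by rewrite eM mulmxBr raddfB /= trG subrr.
  have z : \sum_(G <- Gs) M G *m adj (M G) = 0.
    have e : s *m (\sum_(G <- Gs) M G *m adj (M G)) = \sum_(G <- Gs) M G *m adj (M G).
      by rewrite eM mulmxBr mulmxA sx' -(Gss (adj x *m x)) !mulmxA ss.
    by rewrite -e eS -mulmxA (psd_trM_eq0 psg p t0) mulmx0.
  move=> G GGs; apply/eqP; rewrite -subr_eq0; apply/eqP.
  have MG : M G = 0 by apply: (@gram_sum_eq0 _ _ _ Gs M) => //; rewrite z linear0.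
  by rewrite -[LHS]adjK -/(M G) MG adj0.
exists s, Gs; split => //.
- by move=> X; rewrite !eG Phi_s PhiPhi.
- move=> x y Gx Gy; rewrite -{2}Gx /kraus mulmx_suml; apply: eq_big_seq => G GGs.
  by rewrite -!mulmxA (comm y Gy).
split.
  (* s = 0 would give P 1 = 0, against trace preservation in positive dimension. *)
  apply/eqP => s0; have := trP 1%:M; rewrite -/sg -sA s0 mul0mx linear0 mxtrace1.
  by move/esym/eqP; rewrite pnatr_eq0 => /eqP d1; rewrite d1 in d0.
split => // X Y eY.
by rewrite eP kraus_dual eG -{1}eY !mulmxA mxtrace_mulC !mulmxA.
Qed.

End Idempotent.

(** * Minimal projections *)

Section Atoms.
Context {R : realType}.
Local Notation C := R[i].
Variables (d : nat) (A : 'M[C]_d -> Prop).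
Hypotheses (AD : forall x y, A x -> A y -> A (x + y))
  (AZ : forall a x, A x -> A (a *: x)) (Aadj : forall x, A x -> A (adj x))
  (AM : forall x y, A x -> A y -> A (x *m y)).

Definition projection (q : 'M[C]_d) := [/\ adj q = q, q *m q = q & A q].

Definition atom (p : 'M[C]_d) := [/\ projection p, p != 0 &
  forall q, projection q -> p *m q = q -> q != 0 -> q = p].

Lemma projection_le_comm p q : projection p -> projection q -> p *m q = q -> q *m p = q.
Proof. by move=> [hp _ _] [hq _ _] /(congr1 adj); rewrite adjM hp hq. Qed.

(** The unit of the algebra may differ from 1, so only polynomials without constant term stay inside
    it. This is why a nonzero eigenvalue is taken, and why [q] inherits [p *m x = x]. *)
Lemma spectral_projection x : A x -> adj x = x -> x != 0 ->
  exists (a : C) (q : 'M[C]_d), [/\ projection q, q != 0, x *m q = a *: q &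
    forall p, p *m x = x -> p *m q = q].
Proof.
move=> Ax hx x0; have [U [l [h1 h2 ex]]] := herm_spectral hx.
pose cU (v : 'rV[C]_d) := adj U *m diag_mx v *m U.
have cM v w : cU v *m cU w = cU (\row_j (v 0 j * w 0 j)) by exact: conj_diagM.
have cZ a v : a *: cU v = cU (a *: v).
  by rewrite /cU linearZ /= -scalemxAr -scalemxAl.
have cB v w : cU v - cU w = cU (v - w).
  by rewrite /cU linearB /= mulmxBr mulmxBl.
have [i0 li0] : exists i, l 0 i != 0.
  apply/existsP; apply: contra_neqT x0 => /existsPn h.
  rewrite ex; have -> : l = 0 by apply/rowP=> j; have := h j; rewrite negbK mxE => /eqP.
  by rewrite linear0 mulmx0 mul0mx.
pose a := l 0 i0.
pose y bs := foldr (fun b y => x *m y - b *: y) x bs.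
have Ay bs : A (y bs).
  elim: bs => //= b bs IH; rewrite -scaleN1r scalerA.
  by apply: AD; [apply: AM | apply: AZ].
have py p bs : p *m x = x -> p *m y bs = y bs.
  move=> px; elim: bs => //= b bs IH.
  by rewrite mulmxBr mulmxA px -scalemxAr IH.
have yE bs : y bs = cU (\row_j (l 0 j * \prod_(b <- bs) (l 0 j - b))).
  elim: bs => [|b bs IH] /=.
    by rewrite {1}ex -/(cU l); congr cU; apply/rowP=> j; rewrite mxE big_nil mulr1.
  rewrite IH {1}ex -/(cU l) cM cZ cB; congr cU; apply/rowP=> j.
  by rewrite !mxE big_cons; ring.
(* Lagrange interpolation at a, with an extra factor x so that no unit is needed *)
pose bs := [seq l 0 j | j <- enum 'I_d & l 0 j != a].
pose k := a * \prod_(b <- bs) (a - b).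
have k0 : k != 0.
  rewrite mulf_neq0 // prodf_seq_neq0; apply/allP => b /mapP [j].
  by rewrite mem_filter => /andP [ja _] ->; rewrite /= subr_eq0 eq_sym.
have qE : k^-1 *: y bs = cU (\row_j (l 0 j == a)%:R).
  rewrite yE cZ; congr cU; apply/rowP=> j; rewrite !mxE.
  have [->|ja] := eqVneq; first by rewrite mulVf.
  rewrite (_ : \prod_(b <- bs) _ = 0) ?mulr0 //; apply/eqP.
  rewrite prodf_seq_eq0; apply/hasP; exists (l 0 j); last by rewrite subrr /=.
  by apply/mapP; exists j; rewrite // mem_filter ja mem_enum.
exists a, (k^-1 *: y bs); split.
- split; last exact: AZ.
    by rewrite qE; apply: adj_conj_diag_bool.
  rewrite qE cM; congr cU; apply/rowP=> j; rewrite !mxE.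
  by case: eqP; rewrite ?mulr0 ?mulr1.
- apply/eqP => /(congr1 (fun Z => (U *m Z *m adj U) i0 i0)).
  rewrite qE /cU !mulmxA h1 mul1mx -mulmxA h1 mulmx1 mulmx0 mul0mx !mxE !eqxx.
  by move/eqP; rewrite mulr1n oner_eq0.
- rewrite {1}ex -/(cU l) qE cM cZ; congr cU; apply/rowP=> j; rewrite !mxE.
  by case: eqP => [->|]; rewrite ?mulr0.
- by move=> p px; rewrite -scalemxAr py.
Qed.

(** For Hermitian z, a spectral projection of p z p at a nonzero eigenvalue lies under p, hence
    equals p by minimality; so p z p is that eigenvalue times p. A general x is split into Hermitian
    parts. *)
Lemma atom_scalar p x : atom p -> A x -> exists c : C, p *m x *m p = c *: p.
Proof.
move=> [[hp pp Ap] p0 minp].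
have herm z : A z -> adj z = z -> exists c : C, p *m z *m p = c *: p.
  move=> Az hz; have [->|z0] := eqVneq (p *m z *m p) 0.
    by exists 0; rewrite scale0r.
  have := @spectral_projection (p *m z *m p); case.
  - by do 2?apply: AM.
  - by rewrite !adjM hp hz mulmxA.
  - by [].
  move=> c [q [hq q0 eq pq]]; exists c.
  have eqp : q = p by apply: minp => //; apply: pq; rewrite !mulmxA pp.
  by move: eq; rewrite eqp -!mulmxA pp.
move=> Ax.
have [c1 e1] : exists c : C, p *m (x + adj x) *m p = c *: p.
  by apply: herm; [apply: AD; last apply: Aadj | rewrite adjD adjK addrC].
have [c2 e2] : exists c : C, p *m ('i *: (x - adj x)) *m p = c *: p.
  apply: herm; first by rewrite -scaleN1r; apply/AZ/AD => //; apply/AZ/Aadj.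
  by rewrite adjZ adjB adjK conjCi scaleNr -scalerN opprB.
(* x = 1/2 ((x + adj x) - i (i (x - adj x))). *)
exists (2^-1 * (c1 - 'i * c2)).
rewrite -scalerA scalerBl -scalerA -e1 -e2 -scalemxAr -scalemxAl scalerA.
rewrite -expr2 sqrCi scaleN1r opprK -mulmxDl -mulmxDr.
have -> : x + adj x + (x - adj x) = 2 *: x by rewrite addrACA subrr addr0 scaler_nat mulr2n.
by rewrite -scalemxAr -scalemxAl scalerA mulVf ?scale1r // pnatr_eq0.
Qed.

Lemma projectionB p q : projection p -> projection q -> p *m q = q -> projection (p - q).
Proof.
move=> hp hq pq; have qp := projection_le_comm hp hq pq.
case: hp hq => [hp pp Ap] [hq qq Aq]; split; first by rewrite adjB hp hq.
  by rewrite mulmxBl !mulmxBr pp qq pq qp subrr subr0.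
by rewrite -scaleN1r; apply/AD/AZ.
Qed.

(** The decreasing measure of the two inductions that follow. *)
Lemma projection_rank p q : projection p -> projection q -> p *m q = q -> q != p ->
  (\rank q < \rank p)%N.
Proof.
move=> hp hq pq; have qp := projection_le_comm hp hq pq.
have sub : (q <= p)%MS by rewrite -qp submxMl.
apply: contraNT; rewrite -leqNgt => le.
have [_] := mxrank_leqif_sup sub; rewrite eqn_leq le mxrankS // => /esym /submxP [z ez].
by case: hq => _ qq _; apply/eqP; rewrite -{1}pq ez -mulmxA qq.
Qed.

Lemma exists_atom e : projection e -> e != 0 -> exists2 p, atom p & e *m p = p.
Proof.
move: {2}(\rank e).+1 (ltnSn (\rank e)) => n.
elim: n e => // n IH e le he e0.
have [[q [hq eq q0 qe]]|h] :=
  pselect (exists q, [/\ projection q, e *m q = q, q != 0 & q != e]).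
  have [|p ap qp] := IH q _ hq q0; first exact: leq_trans (projection_rank he hq eq qe) le.
  by exists p => //; rewrite -qp mulmxA eq.
exists e; last by case: he.
split=> // q hq eq q0; apply/eqP/negPn/negP => qe.
by apply: h; exists q.
Qed.

Lemma atomic_decomposition e : projection e ->
  exists (n : nat) (p : 'I_n -> 'M[C]_d), [/\ forall i, atom (p i),
    forall i j, p i *m p j = if i == j then p i else 0 & \sum_i p i = e].
Proof.
move: {2}(\rank e).+1 (ltnSn (\rank e)) => n.
elim: n e => // n IH e le he.
have [->|e0] := eqVneq e 0; first by exists 0%N, (fun _ => 0); split=> [[]|[]|]; rewrite ?big_ord0.
have [p ap ep] := exists_atom he e0; have [hp p0 _] := ap.
have hep := projectionB he hp ep.
have [|m [q [aq qq sq]]] := IH (e - p) _ hep.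
  apply: (leq_trans _ (le : (\rank e <= n)%N)); apply: projection_rank => //.
    by rewrite mulmxBr ep; case: he => _ -> _.
  by rewrite -subr_eq0 addrAC subrr add0r oppr_eq0.
have pq i : p *m q i = 0.
  have -> : q i = (e - p) *m q i.
    rewrite -sq mulmx_suml (bigD1 i) //= qq eqxx big1 ?addr0 // => j /negbTE ji.
    by rewrite qq ji.
  by rewrite mulmxA mulmxBr (projection_le_comm he hp ep) (let: And3 _ h _ := hp in h) subrr mul0mx.
have qp i : q i *m p = 0.
  have := congr1 adj (pq i); rewrite adjM adj0.
  by case: hp (aq i) => -> _ _ [[-> _ _] _ _].
exists m.+1, (fun i => if unlift ord0 i is Some j then q j else p); split.
- by move=> i; case: unliftP.
- move=> i j; case: unliftP => [i'|] ->; case: unliftP => [j'|] ->.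
  + by rewrite qq (inj_eq lift_inj).
  + by rewrite qp.
  + by rewrite pq.
  + by rewrite eqxx; case: hp.
- rewrite big_ord_recl unlift_none; under eq_bigr do rewrite liftK.
  by rewrite sq addrC subrK.
Qed.

End Atoms.

(** * Upper bounds on codes *)

Section Atomic.
Context {R : realType}.
Local Notation C := R[i].

(** The relation [e] may be coarser than [p i *m kraus Gs _ *m p j <> 0], and [kraus Gs]
    stands for the compressed dual of [P]: in this form everything passes to tensor products. *)
Record atomic d (P : 'M[C]_d -> 'M[C]_d) (Gs : seq 'M[C]_d) (I : finType)
    (p : I -> 'M[C]_d) (e : rel I) (k : nat) : Prop := Atomic {
  atomic_adj : forall i, adj (p i) = p i;
  atomic_mul : forall i j, p i *m p j = if i == j then p i else 0;
  atomic_neq0 : forall i, p i != 0;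
  atomic_scal : forall i X, exists c : C, p i *m kraus Gs X *m p i = c *: p i;
  atomic_supp : forall X, (\sum_i p i) *m kraus Gs X *m (\sum_i p i) = kraus Gs X;
  atomic_unit : kraus Gs 1%:M = \sum_i p i;
  atomic_dual : forall X Y, \tr (X *m P Y) = \tr (kraus Gs X *m P Y);
  atomic_sym : symmetric e;
  atomic_rel : forall i j X, ~~ e i j -> p i *m kraus Gs X *m p j = 0;
  atomic_deg : forall i, (#|e i| <= k)%N }.

(** * Sesquilinear forms and sums over a relation *)

Definition qform d (b : 'M[C]_d) (x y : 'cV[C]_d) : C := (adj x *m b *m y) 0 0.

Lemma qformBl d (b : 'M[C]_d) x x' y : qform b (x - x') y = qform b x y - qform b x' y.
Proof. by rewrite /qform adjB 2!mulmxBl mxE; congr (_ + _); rewrite mxE. Qed.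

Lemma qformBr d (b : 'M[C]_d) x y y' : qform b x (y - y') = qform b x y - qform b x y'.
Proof. by rewrite /qform mulmxBr mxE; congr (_ + _); rewrite mxE. Qed.

Lemma qformZl d (b : 'M[C]_d) a x y : qform b (a *: x) y = a^* * qform b x y.
Proof. by rewrite /qform adjZ -2!scalemxAl mxE. Qed.

Lemma qformZr d (b : 'M[C]_d) a x y : qform b x (a *: y) = a * qform b x y.
Proof. by rewrite /qform -scalemxAr mxE. Qed.

Lemma qform1_eq0 d (x : 'cV[C]_d) : qform 1%:M x x = 0 -> x = 0.
Proof.
rewrite /qform mulmx1 => h; rewrite -[x]adjK; apply/(canLR (@adjK _ _ _)); rewrite adj0.
by apply: gram_trace_eq0; rewrite adjK /mxtrace big_ord1.
Qed.

Lemma qform0 d (b : 'M[C]_d) x : qform b 0 x + qform b x 0 = 0.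
Proof. by rewrite /qform adj0 !mul0mx mulmx0 mxE addr0. Qed.

Lemma qform1_ge0 d (x : 'cV[C]_d) : 0 <= qform 1%:M x x.
Proof. by rewrite /qform mulmx1 dot_ge0. Qed.

(** Cauchy-Schwarz combined with the arithmetic-geometric mean inequality. The weights come out
    crossed, so that summing over all pairs yields the sum of the weights times the sum of the
    squared norms. *)
Lemma qform_cross d (b : 'M[C]_d) (x y : 'cV[C]_d) u v : psd b -> 0 <= u -> 0 <= v ->
  qform b x x = u * qform 1%:M x x -> qform b y y = v * qform 1%:M y y ->
  qform b x y + qform b y x <= u * qform 1%:M y y + v * qform 1%:M x x.
Proof.
move=> pb u0 v0 ex ey.
move: (qform1_ge0 x) (qform1_ge0 y) (@qform1_eq0 d x) (@qform1_eq0 d y) ex ey.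
move: (qform 1%:M x x) (qform 1%:M y y) => n m n0 m0 zx zy ex ey.
have [/zx ->|n1] := eqVneq n 0; first by rewrite qform0 addr_ge0 ?mulr_ge0.
have [/zy ->|m1] := eqVneq m 0; first by rewrite addrC qform0 addr_ge0 ?mulr_ge0.
have nm : 0 < n * m by rewrite mulr_gt0 // lt0r ?n1 ?m1.
(* this vector avoids the square roots of sqrt(m/n) x - sqrt(n/m) y *)
have := psd_form (m *: x - n *: y) pb; rewrite -/(qform b _ _).
rewrite qformBl !qformBr !qformZl !qformZr ex ey.
rewrite !conj_Creal ?ger0_real // => h.
rewrite -subr_ge0 -(pmulr_rge0 _ nm); move: h; congr (0 <= _); ring.
Qed.

Lemma psd_delta n (i : 'I_n) : psd (delta_mx i i : 'M[C]_n).
Proof.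
have -> : (delta_mx i i : 'M[C]_n) = delta_mx i (0 : 'I_1) *m adj (delta_mx i 0).
  by rewrite adj_delta mul_delta_mx.
exact: psd_gram.
Qed.

Lemma mxtrace_delta_sandwich m n (M K : 'M[C]_(m, n)) j l :
  \tr (M *m delta_mx l j *m adj M *m (K *m delta_mx j l *m adj K)) =
  (adj K *m M) l l * ((adj K *m M) j j)^*.
Proof.
transitivity (\tr (adj K *m M *m delta_mx l j *m adj (adj K *m M) *m delta_mx j l)).
  by rewrite adjM adjK !mulmxA mxtrace_mulC !mulmxA.
by rewrite mxtrace_mul_delta mulmx_delta_entry adjE.
Qed.

(** Adding f i j + f j i <= f i i + f j j over related pairs bounds the sum by that of deg(i) f i i.
    This is the scalar content of the complete positivity of b |-> k sum_i p_i b p_i - b. *)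
Lemma rel_sum_bound (I : finType) (e : rel I) k (f : I -> I -> C) :
  symmetric e -> (forall i, (#|e i| <= k)%N) -> (forall i, 0 <= f i i) ->
  (forall i j, 0 <= f i i + f j j - f i j - f j i) ->
  \sum_i \sum_(j | e i j) f i j <= k%:R * \sum_i f i i.
Proof.
move=> es ek f0 fe.
have sw (F : I -> I -> C) : \sum_i \sum_(j | e i j) F i j = \sum_i \sum_(j | e i j) F j i.
  rewrite (exchange_big_dep xpredT) //=; apply: eq_bigr => i _; apply: eq_bigl => j.
  by rewrite es.
have dg : \sum_i \sum_(j | e i j) f i i <= k%:R * \sum_i f i i.
  rewrite mulr_sumr; apply: ler_sum => i _.
  by rewrite sumr_const -[X in X <= _]mulr_natl ler_wpM2r // ler_nat.
apply: le_trans _ dg; rewrite -(ler_pM2l (_ : 0 < 2 :> C)) // !mulr_natl !mulr2n.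
rewrite {2}(sw f) {2}(sw (fun i j => f i i)) -!big_split /=.
apply: ler_sum => i _; rewrite -!big_split /=; apply: ler_sum => j _.
by have := fe i j; rewrite -addrA -opprD subr_ge0.
Qed.

(** * Bounds from atomic data *)

Section Upper.
Variables (d : nat) (P : 'M[C]_d -> 'M[C]_d) (Gs : seq 'M[C]_d) (I : finType).
Variables (p : I -> 'M[C]_d) (e : rel I) (k : nat).
Hypothesis hP : atomic P Gs p e k.
Let s := \sum_i p i.

Let pp i : p i *m p i = p i.
Proof. by rewrite (atomic_mul hP) eqxx. Qed.

Let psd_p i : psd (p i).
Proof. by rewrite -pp -{2}(atomic_adj hP); apply: psd_gram. Qed.

Let tr_p i : 0 < \tr (p i).
Proof.
rewrite lt0r psd_tr_ge0 ?andbT //; apply: contraNneq (atomic_neq0 hP i).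
by move/(psd_tr_eq0 (psd_p i)) => ->.
Qed.

Let ps i : p i *m s = p i.
Proof.
rewrite mulmx_sumr (bigD1 i) //= pp big1 ?addr0 // => j /negbTE ji.
by rewrite (atomic_mul hP) eq_sym ji.
Qed.

Let psd_1s : psd (1%:M - s).
Proof.
have hs : adj s = s by rewrite adj_sum; apply: eq_bigr => i _; rewrite (atomic_adj hP).
have ss : s *m s = s by rewrite {1}/s mulmx_suml; apply: eq_bigr => i _; apply: ps.
have -> : 1%:M - s = (1%:M - s) *m adj (1%:M - s).
  by rewrite adjB adj1 hs mulmxBl !mulmxBr !mulmx1 mul1mx ss subrr subr0.
exact: psd_gram.
Qed.

Lemma atomic_tr_gt0 i : 0 < \tr (p i).
Proof. exact: tr_p. Qed.

(** The scalar w_i(Gamma(X)), written as a normalised trace so that linearity and positivity in X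
    can be read off. *)
Definition weight i X : C := \tr (p i *m kraus Gs X) / \tr (p i).

Lemma weightE i X : p i *m kraus Gs X *m p i = weight i X *: p i.
Proof.
have [c ec] := atomic_scal hP i X; rewrite ec; congr (_ *: _).
have := congr1 mxtrace ec; rewrite mxtrace_mulC mulmxA pp mxtraceZ /weight => ->.
by rewrite mulfK // gt_eqF.
Qed.

Lemma weight1 i : weight i 1%:M = 1.
Proof. by rewrite /weight (atomic_unit hP) ps divff // gt_eqF. Qed.

Lemma weight_ge0 i X : psd X -> 0 <= weight i X.
Proof.
move=> pX; apply: divr_ge0; last exact: ltW.
exact: (psd_trM_ge0 (psd_p i) (psd_kraus Gs pX)).
Qed.

Lemma weight_sum i (J : Type) (r : seq J) (Q : pred J) (F : J -> 'M[C]_d) :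
  weight i (\sum_(j <- r | Q j) F j) = \sum_(j <- r | Q j) weight i (F j).
Proof.
by rewrite /weight (linmap_sum (linmap_kraus _)) mulmx_sumr raddf_sum mulr_suml.
Qed.

Lemma sum_sandwich y : s *m y *m s = \sum_i \sum_j p i *m y *m p j.
Proof.
rewrite /s mulmx_suml mulmx_suml; apply: eq_bigr => i _.
by rewrite mulmx_sumr.
Qed.

(** Decompose v into the p_i v: the form of b is w_i times the squared norm on each component, and
    [qform_cross] controls the mixed terms. On a full matrix algebra this is b <= (tr b) 1. *)
Lemma kraus_le_weight X : psd X -> psd ((\sum_i weight i X)%:M - kraus Gs X).
Proof.
move=> pX; set b := kraus Gs X; set f := \sum_i _.
have pb : psd b by apply: psd_kraus.
have f0 : 0 <= f by apply: sumr_ge0 => i _; apply: weight_ge0.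
split.
  rewrite adjB (psd_adj pb); congr (_ - _).
  apply/matrixP=> i j; rewrite !mxE eq_sym rmorphMn /=.
  by rewrite conj_Creal // ger0_real.
move=> v.
pose w i := p i *m v.
have wE c i j : qform c (w i) (w j) = (adj v *m (p i *m c *m p j) *m v) 0 0.
  by rewrite /qform /w adjM (atomic_adj hP) !mulmxA.
have W i' : 0 <= weight i' X by apply: weight_ge0.
have Bii i : qform b (w i) (w i) = weight i X * qform 1%:M (w i) (w i).
  by rewrite !wE weightE mulmx1 pp -scalemxAr -scalemxAl mxE.
have eb : qform b v v = \sum_i \sum_j qform b (w i) (w j).
  have eB : b = \sum_i \sum_j p i *m b *m p j by rewrite -sum_sandwich; exact: (esym (atomic_supp hP X)).
  rewrite {1}/qform {1}eB mulmx_sumr mulmx_suml summxE; apply: eq_bigr => i _.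
  rewrite mulmx_sumr mulmx_suml summxE; apply: eq_bigr => j _.
  by rewrite wE.
(* Bessel's inequality: the p_i are orthogonal with sum s <= 1. *)
have en : \sum_i qform 1%:M (w i) (w i) <= qform 1%:M v v.
  rewrite -subr_ge0; have := psd_form v psd_1s.
  rewrite mulmxBr mulmxBl mxE [X in _ + X]mxE; congr (0 <= _ - _).
  rewrite mulmx_sumr mulmx_suml summxE; apply: eq_bigr => i _.
  by rewrite wE mulmx1 pp.
rewrite mulmxBr mulmxBl mxE [X in _ + X]mxE subr_ge0 -/(qform b v v) eb.
have -> : (adj v *m f%:M *m v) 0 0 = f * qform 1%:M v v.
  by rewrite mul_mx_scalar -scalemxAl mxE /qform mulmx1.
apply: le_trans (ler_wpM2l f0 en).
(* Doubling pairs the terms (i, j) and (j, i), as [qform_cross] requires. *)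
rewrite -(ler_pM2l (_ : 0 < 2 :> C)) // mulr_natl mulr2n [X in _ + X]exchange_big -big_split /=.
under eq_bigr do rewrite -big_split /=.
apply: (@le_trans _ _ (\sum_i \sum_j (weight i X * qform 1%:M (w j) (w j) +
    weight j X * qform 1%:M (w i) (w i)))).
  by apply: ler_sum => i _; apply: ler_sum => j _; apply: qform_cross.
have e2 : \sum_i \sum_j weight i X * qform 1%:M (w j) (w j) =
    f * \sum_i qform 1%:M (w i) (w i).
  by rewrite mulr_suml; apply: eq_bigr => i _; rewrite mulr_sumr.
rewrite mulr_natl mulr2n -{1}e2 -e2 [X in _ <= _ + X]exchange_big -big_split /=.
by apply: ler_sum => i _; rewrite -big_split.
Qed.

(** In the Heisenberg picture the decoder turns the |i><i| into effects with sum 1. Each success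
    probability is at most the sum over j of the weights w_j of its effect, and every w_j is 1 on
    the sum of the effects. *)
Lemma atomic_classical_bound D (E : 'M[C]_D -> 'M[C]_d) (Rc : 'M[C]_d -> 'M[C]_D) :
  channel P -> channel E -> channel Rc ->
  D%:R <= \sum_(i < D) (Rc (P (E (delta_mx i i)))) i i -> (D <= #|I|)%N.
Proof.
move=> chP chE /kraus_channel [Rs [_ eR tR]] h.
rewrite -(ler_nat C); apply: le_trans h _.
have [Es [_ eE tE]] := kraus_channel (channel_comp chE chP).
apply: (@le_trans _ _ (\sum_(i < D) \sum_j weight j (kraus (adjs Rs) (delta_mx i i)))).
  apply: ler_sum => i _; rewrite -mxtrace_mul_delta mxtrace_mulC eR kraus_dual.
  rewrite (atomic_dual hP).
  have ppsd : psd (P (E (delta_mx i i))) by rewrite eE; apply/psd_kraus/psd_delta.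
  have := psd_trM_ge0 (kraus_le_weight (psd_kraus (adjs Rs) (psd_delta i))) ppsd.
  rewrite mulmxBl mul_scalar_mx raddfB /= mxtraceZ subr_ge0 => h1.
  apply: le_trans h1 _.
  have [_ [_ trP]] := chP; have [_ [_ trE]] := chE.
  by rewrite trP trE mxtrace_delta mulr1.
rewrite exchange_big /=; under eq_bigr do
  rewrite -weight_sum -(linmap_sum (linmap_kraus _)) -mx1_sum_delta tR weight1.
by rewrite sumr_const.
Qed.

(** The fidelity is a pairing of the dual decoder with P o E that is nonnegative on completely
    positive maps. Cutting the dual decoder by the p_i gives a family to which [rel_sum_bound]
    applies; its diagonal part contributes at most D, whence D^2 <= k D. *)
Lemma atomic_quantum_bound D (E : 'M[C]_D -> 'M[C]_d) (Rc : 'M[C]_d -> 'M[C]_D) :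
  channel P -> channel E -> channel Rc ->
  (D%:R) ^+ 2 <= \sum_(j < D) \sum_(l < D) (Rc (P (E (delta_mx j l)))) j l -> (D <= k)%N.
Proof.
move=> chP chE /kraus_channel [Rs [_ eR tR]] h.
have [D0|D0] := posnP D; first by rewrite D0.
have [Es [_ eE tE]] := kraus_channel (channel_comp chE chP).
have eE1 : \tr (kraus Es 1%:M) = D%:R.
  by rewrite -eE; case: chP => _ [_ ->]; case: chE => _ [_ ->]; rewrite mxtrace1.
pose FF (L : 'M[C]_D -> 'M[C]_d) :=
  \sum_j \sum_l \tr (L (delta_mx l j) *m kraus Es (delta_mx j l)).
have FF_kraus Ms : 0 <= FF (kraus Ms).
  have -> : FF (kraus Ms) = \sum_(M <- Ms) \sum_(K <- Es) `|\tr (adj K *m M)| ^+ 2.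
    rewrite /FF pair_bigA /=.
    transitivity (\sum_(jl : 'I_D * 'I_D) \sum_(M <- Ms) \sum_(K <- Es)
        (adj K *m M) jl.2 jl.2 * ((adj K *m M) jl.1 jl.1)^*).
      apply: eq_bigr => -[j l] _ /=; rewrite /kraus mulmx_suml raddf_sum.
      apply: eq_bigr => M _ /=; rewrite mulmx_sumr raddf_sum; apply: eq_bigr => K _ /=.
      exact: mxtrace_delta_sandwich.
    rewrite exchange_big; apply: eq_bigr => M _; rewrite exchange_big; apply: eq_bigr => K _ /=.
    rewrite -(pair_bigA _ (fun j l => (adj K *m M) l l * ((adj K *m M) j j)^*)) /=.
    rewrite normCK {1}/mxtrace mulr_suml exchange_big; apply: eq_bigr => l _ /=.
    by rewrite /mxtrace rmorph_sum mulr_sumr.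
  by apply: sumr_ge0 => M _; apply: sumr_ge0 => K _; rewrite exprn_ge0.
pose Rd := kraus (adjs Rs).
pose L0 X := kraus Gs (Rd X).
(* [FF L0] is D^2 times the entanglement fidelity: inserting Gamma after the dual decoder changes
   nothing, by [atomic_dual]. *)
have FF0 : (D%:R) ^+ 2 <= FF L0.
  apply: le_trans h _; rewrite le_eqVlt; apply/orP; left; apply/eqP.
  apply: eq_bigr => j _; apply: eq_bigr => l _.
  by rewrite -mxtrace_mul_delta mxtrace_mulC eR (kraus_dual Rs) (atomic_dual hP) eE.
pose y i j X := p i *m L0 X *m p j.
have FFy i j : FF (fun X => (p i - p j) *m L0 X *m (p i - p j)) =
  FF (y i i) + FF (y j j) - FF (y i j) - FF (y j i).
  rewrite /FF -!big_split -!sumrB /=; apply: eq_bigr => a _.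
  rewrite -!big_split -!sumrB /=; apply: eq_bigr => b _.
  have -> : (p i - p j) *m L0 (delta_mx b a) *m (p i - p j) = y i i (delta_mx b a) +
      y j j (delta_mx b a) - y i j (delta_mx b a) - y j i (delta_mx b a).
    rewrite 2!mulmxBl 2!mulmxBr opprB addrA; congr (_ - _).
    by rewrite addrAC.
  by rewrite 2!mulmxBl mulmxDl 2!raddfB raddfD.
have FFpos i j : 0 <= FF (fun X => (p i - p j) *m L0 X *m (p i - p j)).
  have := FF_kraus [seq (p i - p j) *m M | M <- [seq G *m K | G <- Gs, K <- adjs Rs]].
  congr (0 <= _); apply: eq_bigr => a _; apply: eq_bigr => b _; congr (\tr (_ *m _)).
  rewrite /L0 /Rd kraus_comp /kraus big_map mulmx_sumr mulmx_suml; apply: eq_bigr => M _.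
  by rewrite adjM adjB !(atomic_adj hP) !mulmxA.
have FFii i : 0 <= FF (y i i).
  have := FF_kraus [seq p i *m M | M <- [seq G *m K | G <- Gs, K <- adjs Rs]].
  congr (0 <= _); apply: eq_bigr => a _; apply: eq_bigr => b _; congr (\tr (_ *m _)).
  rewrite /y /L0 /Rd kraus_comp /kraus big_map mulmx_sumr mulmx_suml; apply: eq_bigr => M _.
  by rewrite adjM !(atomic_adj hP) !mulmxA.
have FFsum (L : I -> 'M[C]_D -> 'M[C]_d) : FF (fun X => \sum_i L i X) = \sum_i FF (L i).
  rewrite /FF [RHS]exchange_big; apply: eq_bigr => a _ /=.
  rewrite [RHS]exchange_big; apply: eq_bigr => b _ /=.
  by rewrite mulmx_suml raddf_sum.
have FFL0 : FF L0 = \sum_i \sum_(j | e i j) FF (y i j).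
  transitivity (\sum_i \sum_j FF (y i j)); last first.
    apply: eq_bigr => i _; rewrite [RHS]big_mkcond; apply: eq_bigr => j _ /=.
    case: ifPn => // /(atomic_rel hP) h0; rewrite /FF big1 // => a _; rewrite big1 // => b _.
    by rewrite /y h0 mul0mx linear0.
  have -> : L0 = fun X => \sum_i \sum_j y i j X.
    by apply/funext => X; rewrite {1}/L0 -(atomic_supp hP) sum_sandwich.
  by rewrite FFsum; apply: eq_bigr => i _; rewrite FFsum.
have FFle : FF L0 <= k%:R * \sum_i FF (y i i).
  rewrite FFL0; apply: (@rel_sum_bound I e k (fun i j => FF (y i j))).
  - exact: (atomic_sym hP).
  - exact: (atomic_deg hP).
  - exact: FFii.
  - by move=> i j; rewrite -FFy.
(* [y i i X] is a functional of X times p_i, so the pairing becomes the trace of a product. [Z] is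
   the density matrix of that functional, of trace 1 because the dual decoder and the weight are
   unital. *)
have FFm i : FF (y i i) <= \tr (p i *m kraus Es 1%:M).
  pose Z := (\tr (p i))^-1 *: kraus (adjs (adjs Rs)) (kraus (adjs Gs) (p i)).
  pose Y := kraus (adjs Es) (p i).
  have eZ X : weight i (Rd X) = \tr (Z *m X).
    by rewrite /weight /Rd !kraus_dual /Z -scalemxAl mxtraceZ mulrC.
  have -> : FF (y i i) = \tr (Z *m Y).
    rewrite /FF /mxtrace; apply: eq_bigr => j _; rewrite mxE; apply: eq_bigr => l _.
    rewrite /y weightE -scalemxAl -/(\tr _) linearZ /= eZ mxtrace_mul_delta.
    by rewrite kraus_dual mxtrace_mul_delta.
  have pZ : psd Z.
    by apply: psdZ; [rewrite invr_ge0 ltW | do 2!apply: psd_kraus].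
  have pY : psd Y by apply: psd_kraus.
  apply: le_trans (psd_trM_le pZ pY) _.
  by rewrite -[Z]mulmx1 -eZ /Rd tR weight1 mul1r kraus_dual mulmx1.
have FFs : \sum_i FF (y i i) <= D%:R.
  apply: (@le_trans _ _ (\tr (s *m kraus Es 1%:M))).
    by rewrite mulmx_suml raddf_sum; apply: ler_sum => i _; apply: FFm.
  have := psd_trM_ge0 psd_1s (psd_kraus Es (psd1 D)).
  by rewrite mulmxBl mul1mx raddfB /= eE1 subr_ge0.
have : D%:R ^+ 2 <= k%:R * D%:R :> C.
  by apply: le_trans FF0 _; apply: le_trans FFle _; rewrite ler_wpM2l.
by rewrite expr2 ler_pM2r ?ltr0n // ler_nat.
Qed.

End Upper.

(** The full matrix algebra as a single block. It yields D <= d for codes of arbitrary channels. *)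
Lemma atomic_id d : atomic (id : 'M[C]_d -> 'M[C]_d) [:: 1%:M]
  (fun i : 'I_d => delta_mx i i) (fun _ _ => true) d.
Proof.
split=> //.
- by move=> i; rewrite adj_delta.
- move=> i j; case: eqP => [->|/eqP ij]; first by rewrite mul_delta_mx.
  by rewrite mul_delta_mx_0.
- move=> i; apply/eqP => /matrixP /(_ i i); rewrite !mxE !eqxx => /eqP.
  by rewrite oner_eq0.
- by move=> i X; exists (X i i); rewrite kraus1 mulmx_delta2.
- by move=> X; rewrite kraus1 -mx1_sum_delta mul1mx mulmx1.
- by rewrite kraus1 -mx1_sum_delta.
- by move=> X Y; rewrite kraus1.
- by move=> i; apply: leq_trans (max_card _) _; rewrite card_ord.
Qed.

End Atomic.

(** * Tensor products and codes *)

Section Codes.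
Context {R : realType}.
Local Notation C := R[i].

(** Every condition that quantifies over matrices survives linear combinations, so [tensmx_ind]
    reduces it to Kronecker products, where it holds factor by factor. Minimality of p_i (x) p'_j
    enters only through the scalar condition. *)
Lemma atomic_tens d d' (P : 'M[C]_d -> 'M[C]_d) (P' : 'M[C]_d' -> 'M[C]_d')
    Gs Gs' (I I' : finType) (p : I -> 'M[C]_d) (p' : I' -> 'M[C]_d') e e' k k' :
  linmap P -> linmap P' -> atomic P Gs p e k -> atomic P' Gs' p' e' k' ->
  atomic (tensmap P P') [seq G *t H | G <- Gs, H <- Gs']
    (fun i : I * I' => p i.1 *t p' i.2)
    (fun i j => e i.1 j.1 && e' i.2 j.2) (k * k').
Proof.
move=> lP lP' h h'.
have lG := linmap_kraus Gs; have lG' := linmap_kraus Gs'.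
have lT := linmap_tensmap (kraus Gs) (kraus Gs').
have ep : \sum_(i : I * I') p i.1 *t p' i.2 = (\sum_i p i) *t (\sum_i p' i).
  rewrite -(pair_bigA _ (fun i j => p i *t p' j)) tensmx_suml /=.
  by apply: eq_bigr => i _; rewrite tensmx_sumr.
split.
- by move=> i; rewrite adj_tens (atomic_adj h) (atomic_adj h').
- move=> [i i'] [j j'] /=; rewrite tensmx_mul (atomic_mul h) (atomic_mul h') xpair_eqE.
  by case: eqP => [_|_]; [case: eqP => _; rewrite ?tensmx0 | rewrite tens0mx].
- move=> [i i'] /=; apply/eqP => /(congr1 mxtrace).
  rewrite mxtrace_tens linear0 => /eqP; rewrite mulf_eq0.
  by rewrite !gt_eqF ?(atomic_tr_gt0 h) ?(atomic_tr_gt0 h').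
- move=> [i i'] X /=; rewrite kraus_tens.
  elim/(@tensmx_ind R d d d' d'): X => [X Y [c ec] [c' ec']|a X [c ec]|A B].
  + by exists (c + c'); rewrite (linmapD lT) mulmxDr mulmxDl ec ec' scalerDl.
  + by exists (a * c); rewrite (linmapZ lT) -scalemxAr -scalemxAl ec scalerA.
  + have [c ec] := atomic_scal h i A; have [c' ec'] := atomic_scal h' i' B.
    exists (c * c'); rewrite tensmap_tens // !tensmx_mul ec ec'.
    by rewrite tensmxZl tensmxZr scalerA.
- move=> X; rewrite kraus_tens ep; elim/(@tensmx_ind R d d d' d'): X => [X Y eX eY|a X eX|A B].
  + by rewrite (linmapD lT) mulmxDr mulmxDl eX eY.
  + by rewrite (linmapZ lT) -scalemxAr -scalemxAl eX.
  + by rewrite tensmap_tens // !tensmx_mul (atomic_supp h) (atomic_supp h').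
- by rewrite kraus_tens ep -tensmx11 tensmap_tens // (atomic_unit h) (atomic_unit h').
- move=> X Y; rewrite kraus_tens; elim/(@tensmx_ind R d d d' d'): X => [X X' eX eX'|a X eX|A B].
  + by rewrite (linmapD lT) !mulmxDl !mxtraceD eX eX'.
  + by rewrite (linmapZ lT) -!scalemxAl !mxtraceZ eX.
  have lPP := linmap_tensmap P P'.
  elim/(@tensmx_ind R d d d' d'): Y => [Y Y' eY eY'|a Y eY|A' B'].
  + by rewrite (linmapD lPP) !mulmxDr !mxtraceD eY eY'.
  + by rewrite (linmapZ lPP) -!scalemxAr !mxtraceZ eY.
  + by rewrite !tensmap_tens // !tensmx_mul !mxtrace_tens (atomic_dual h) (atomic_dual h').
- by move=> [i i'] [j j'] /=; rewrite (atomic_sym h) (atomic_sym h').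
- move=> [i i'] [j j'] X /= ne; rewrite kraus_tens.
  elim/(@tensmx_ind R d d d' d'): X => [X Y eX eY|a X eX|A B].
  + by rewrite (linmapD lT) mulmxDr mulmxDl eX eY addr0.
  + by rewrite (linmapZ lT) -scalemxAr -scalemxAl eX scaler0.
  + rewrite tensmap_tens // !tensmx_mul; move: ne; rewrite negb_and.
    by case/orP => [/(atomic_rel h) ->|/(atomic_rel h') ->]; rewrite ?tens0mx ?tensmx0.
- move=> [i i'].
  have -> : #|(fun j : I * I' => e i j.1 && e' i' j.2)| = (#|e i| * #|e' i'|)%N.
    by rewrite -cardX; apply: eq_card => -[j j'].
  by rewrite leq_mul // ?(atomic_deg h) ?(atomic_deg h').
Qed.

(** The exact forms serve constructions, as they tensor directly; the inequalities
    [classical_exists] and [quantum_exists] below match the definitions and pass to limits. Only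
    exact implies inequality is proved: matching bounds close the gap. *)
Definition perfect_classical d D (T : 'M[C]_d -> 'M[C]_d) : Prop :=
  exists (E : 'M[C]_D -> 'M[C]_d) (Rc : 'M[C]_d -> 'M[C]_D),
    [/\ channel E, channel Rc & forall i, Rc (T (E (delta_mx i i))) i i = 1].

Definition perfect_quantum d D (T : 'M[C]_d -> 'M[C]_d) : Prop :=
  exists (E : 'M[C]_D -> 'M[C]_d) (Rc : 'M[C]_d -> 'M[C]_D),
    [/\ channel E, channel Rc & forall X, Rc (T (E X)) = X].

(** A decoder that works on the range of z is completed by resetting the complement to |j0>, with
    Kraus operators |j0><k| (1 - z). *)
Lemma complete_channel d n (Ks : seq 'M[C]_(n, d)) (z : 'M[C]_d) (j0 : 'I_n) :
  adj z = z -> z *m z = z -> kraus (adjs Ks) 1%:M = z ->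
  exists Rc : 'M[C]_d -> 'M[C]_n, channel Rc /\
    forall Y, Rc Y = kraus Ks Y + \tr ((1%:M - z) *m Y) *: delta_mx j0 j0.
Proof.
move=> hz zz eK; set c := 1%:M - z.
have hc : adj c = c by rewrite adjB adj1 hz.
have cc : c *m c = c by rewrite mulmxBl !mulmxBr !mulmx1 mul1mx zz subrr subr0.
pose Ls : seq 'M[C]_(n, d) := [seq delta_mx j0 k *m c | k <- enum 'I_d].
exists (kraus (Ks ++ Ls)); split.
  apply: channel_kraus; rewrite kraus_adjs big_cat -kraus_adjs eK big_map big_enum /=.
  transitivity (z + c); last by rewrite addrC subrK.
  congr (_ + _); transitivity (c *m 1%:M *m c); last by rewrite mulmx1.
  rewrite [in RHS]mx1_sum_delta mulmx_sumr mulmx_suml.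
  apply: eq_bigr => k _; rewrite adjM hc adj_delta mulmx1.
  by rewrite !mulmxA -(mulmxA c) mul_delta_mx.
move=> Y; rewrite {1}/kraus big_cat; congr (_ + _).
have -> : \tr (c *m Y) = \tr (c *m Y *m c) by rewrite [RHS]mxtrace_mulC mulmxA cc.
rewrite big_map big_enum /= /mxtrace scaler_suml.
apply: eq_bigr => k _.
by rewrite adjM hc adj_delta -mulmx_delta2 !mulmxA.
Qed.

Lemma unit_vector d (p : 'M[C]_d) : p *m p = p -> p != 0 ->
  exists u : 'cV[C]_d, p *m u = u /\ adj u *m u = 1%:M.
Proof.
move=> pp p0.
have [j pj] : exists j, col j p != 0.
  apply/existsP; apply: contra_neqT p0 => /existsPn h; apply/matrixP=> i j.
  by have := h j; rewrite negbK => /eqP /matrixP /(_ i 0); rewrite !mxE.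
pose w := col j p; pose n := (adj w *m w) 0 0.
have pw : p *m w = w by rewrite /w colE mulmxA pp.
have n0 : 0 <= n by apply: dot_ge0.
have nn : n != 0.
  apply: contraNneq pj => h; apply/eqP/qform1_eq0.
  by rewrite /qform mulmx1.
exists ((sqrtC n)^-1 *: w); split; first by rewrite -scalemxAr pw.
rewrite adjZ -scalemxAl -scalemxAr scalerA [adj w *m w]mx11_scalar -/n scale_scalar_mx.
rewrite conj_Creal ?ger0_real ?invr_ge0 ?sqrtC_ge0 //.
by rewrite -invfM -expr2 sqrtCK mulVf.
Qed.

End Codes.

(** * Perfect codes of an idempotent channel *)

Section IdempotentCodes.
Context {R : realType}.
Local Notation C := R[i].

(** Classical code: send i to a pure state under p_i and measure the p_j. Quantum code: from an atom
    i0 with the most related atoms, partial isometries v_a of the algebra reach those atoms; the v_a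
    psi span the code space, and P preserves the expectations of the Gamma-fixed v_b (adj v_a). *)
Lemma idempotent_codes d (P : 'M[C]_d -> 'M[C]_d) :
  (0 < d)%N -> channel P -> (forall X, P (P X) = P X) ->
  exists (Gs : seq 'M[C]_d) (n : nat) (p : 'I_n -> 'M[C]_d) (e : rel 'I_n) (k : nat),
    [/\ (0 < n)%N, (0 < k)%N, atomic P Gs p e k,
        perfect_classical n P & perfect_quantum k P].
Proof.
move=> d0 chP PP.
have [s [Gs [[hs ss] [G1 Gss] GG Gmul [s0 [Ps dual]]]]] := idempotent_algebra d0 chP PP.
have lG := linmap_kraus Gs.
pose A x := kraus Gs x = x.
have AD x y : A x -> A y -> A (x + y) by move=> hx hy; rewrite /A (linmapD lG) hx hy.
have AZ a x : A x -> A (a *: x) by move=> hx; rewrite /A (linmapZ lG) hx.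
have Aadj x : A x -> A (adj x) by move=> hx; rewrite /A -adj_kraus hx.
have AM x y : A x -> A y -> A (x *m y) by move=> hx hy; apply: Gmul.
have As : A s by rewrite /A -{1}G1 GG.
have [n [p [ap pp ps]]] := atomic_decomposition AD AZ (And3 hs ss As).
have hp i : adj (p i) = p i by case: (ap i) => -[].
have pii i : p i *m p i = p i by rewrite pp eqxx.
have Ap i : A (p i) by case: (ap i) => -[].
have p0 i : p i != 0 by case: (ap i).
have sp i : s *m p i = p i.
  rewrite -ps mulmx_suml (bigD1 i) //= pp eqxx big1 ?addr0 // => j /negbTE ji.
  by rewrite pp ji.
pose e : rel 'I_n := fun i j => `[< exists X, p i *m kraus Gs X *m p j != 0 >].
pose k := (\max_i #|e i|)%N.
have n0 : (0 < n)%N.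
  by move: s0; rewrite -ps; case: (n) p {ap pp ps hp pii Ap p0 sp e k} => // p; rewrite big_ord0 eqxx.
have eii i : e i i.
  by apply/asboolP; exists (p i); rewrite (Ap i) !pii.
have e_sym : symmetric e.
  have h i j : e i j -> e j i.
    move=> /asboolP [X hX]; apply/asboolP; exists (adj X).
    apply: contraNneq hX => /(congr1 adj); rewrite adj0 !adjM !hp adj_kraus adjK mulmxA.
    by move=> ->.
  by move=> i j; apply/idP/idP; apply: h.
have AT : atomic P Gs p e k.
  split=> //.
  - by move=> i X; apply: (atom_scalar AD AZ Aadj AM (ap i)); apply: GG.
  - by move=> X; rewrite ps Gss.
  - by rewrite ps G1.
  - by move=> X Y; rewrite -{1}PP dual.
  - by move=> i j X; apply: contraNeq => h; apply/asboolP; exists X.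
  - by move=> i; apply: (leq_bigmax i).
have [i0 ei0] : exists i0, #|e i0| = k.
  have [|i0 h] := @bigop.eq_bigmax 'I_n (fun i => #|e i|); first by rewrite card_ord.
  by exists i0.
have k0 : (0 < k)%N by rewrite -ei0; apply/card_gt0P; exists i0; apply: eii.
have uP i : exists u : 'cV[C]_d, p i *m u = u /\ adj u *m u = 1%:M by apply: unit_vector.
have [u hu] := choice uP.
exists Gs, n, p, e, k; split => //.
- pose Es : seq 'M[C]_(d, n) := [seq u i *m delta_mx 0 i | i <- enum 'I_n].
  have cE : channel (kraus Es).
    apply: channel_kraus; rewrite kraus_adjs big_map big_enum /= [in RHS]mx1_sum_delta.
    apply: eq_bigr => i _; rewrite adjM adj_delta mulmx1 mulmxA -(mulmxA (delta_mx i 0)).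
    by have [_ ->] := hu i; rewrite mulmx1 mul_delta_mx.
  have EE i : kraus Es (delta_mx i i) = u i *m adj (u i).
    rewrite /kraus big_map big_enum /= (bigD1 i) //= big1 ?addr0 => [|j ji]; last first.
      by rewrite -!mulmxA (mulmxA (delta_mx 0 j)) mul_delta_mx_0 // mul0mx mulmx0.
    rewrite adjM adj_delta !mulmxA -(mulmxA (u i)) mul_delta_mx -(mulmxA (u i)) mul_delta_mx.
    by rewrite [delta_mx 0 0]mx11_scalar mxE !eqxx mulmx1.
  pose Ks : seq 'M[C]_(n, d) := [seq delta_mx i l *m p i | i <- enum 'I_n, l <- enum 'I_d].
  have [|Rc [cR eR]] := @complete_channel R d n Ks s (Ordinal n0) hs ss.
    rewrite kraus_adjs big_allpairs_dep -ps big_enum; apply: eq_bigr => i _ /=.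
    transitivity (p i *m 1%:M *m p i); last by rewrite mulmx1 pii.
    rewrite big_enum [in RHS]mx1_sum_delta mulmx_sumr mulmx_suml; apply: eq_bigr => l _ /=.
    by rewrite adjM hp adj_delta mulmx1 !mulmxA -(mulmxA (p i)) mul_delta_mx.
  exists (kraus Es), Rc; split => // i.
  have su : s *m (u i *m adj (u i)) *m s = u i *m adj (u i).
    have su : s *m u i = u i by have [<- _] := hu i; rewrite mulmxA sp.
    by rewrite mulmxA su -mulmxA -{1}hs -adjM su.
  have trj j : \tr (p j *m P (u i *m adj (u i))) = (j == i)%:R.
    rewrite dual // (Ap j); have [e1 e2] := hu i; rewrite mulmxA -{1}e1 mulmxA pp.
    case: eqP => [->|_]; last by rewrite !mul0mx linear0.
    by rewrite e1 mxtrace_mulC e2 mxtrace1.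
  rewrite EE eR mulmxBl mul1mx.
  (* Outputs of P live on s, so the completion term of the decoder vanishes. *)
  have -> : \tr (P (u i *m adj (u i)) - s *m P (u i *m adj (u i))) = 0.
    by rewrite -{2}Ps !mulmxA ss Ps subrr linear0.
  rewrite scale0r addr0 /kraus big_allpairs_dep big_enum /= summxE.
  transitivity (\sum_j \tr (p j *m P (u i *m adj (u i))) * (delta_mx j j : 'M[C]_n) i i).
    apply: eq_bigr => j _.
    have -> : \tr (p j *m P (u i *m adj (u i))) = \tr (p j *m P (u i *m adj (u i)) *m p j).
      by rewrite [RHS]mxtrace_mulC mulmxA pii.
    rewrite big_enum /= summxE mulr_suml; apply: eq_bigr => l _.
    rewrite adjM hp adj_delta.
    transitivity ((delta_mx j l *m (p j *m P (u i *m adj (u i)) *m p j) *m delta_mx l j) i i).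
      by rewrite !mulmxA.
    by rewrite mulmx_delta2 mxE.
  rewrite (bigD1 i) //= big1 => [|j /negbTE ji]; last by rewrite trj ji mul0r.
  by rewrite trj eqxx mxE !eqxx mul1r addr0.
(* A nonzero corner element w from p_i0 to p_j has adj w w in C p_i0, so rescaling makes it a
   partial isometry. The value 0 for unrelated j only makes the choice total. *)
have vP j : exists v : 'M[C]_d, e i0 j ->
    [/\ A v, p j *m v = v, v *m p i0 = v & adj v *m v = p i0].
  case: (boolP (e i0 j)) => [|_]; last by exists 0.
  rewrite e_sym => /asboolP [X hX]; set w := p j *m kraus Gs X *m p i0.
  have Aw : A w by apply: (AM _ _ (AM _ _ (Ap j) (GG X)) (Ap i0)).
  have pw : p j *m w = w by rewrite /w !mulmxA pii.
  have wp : w *m p i0 = w by rewrite /w -!mulmxA pii.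
  have [c ec] := atom_scalar AD AZ Aadj AM (ap i0) (AM _ _ (Aadj _ Aw) Aw).
  have {}ec : adj w *m w = c *: p i0.
    by rewrite -ec -{1 2}wp adjM hp !mulmxA.
  have c0 : 0 < c.
    have : 0 < \tr (adj w *m w).
      rewrite lt0r mxtrace_mulC gram_trace_ge0 andbT.
      by apply: contraNneq hX => /gram_trace_eq0 h; apply/eqP.
    by rewrite ec mxtraceZ pmulr_lgt0 // (atomic_tr_gt0 AT).
  exists ((sqrtC c)^-1 *: w) => _; split.
  - exact: AZ.
  - by rewrite -scalemxAr pw.
  - by rewrite -scalemxAl wp.
  rewrite adjZ -scalemxAl -scalemxAr scalerA ec scalerA.
  rewrite conj_Creal ?ger0_real ?invr_ge0 ?sqrtC_ge0 ?ltW //.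
  by rewrite -invfM -expr2 sqrtCK mulVf ?scale1r // gt_eqF.
have [v0 hv0] := choice vP.
have [f fi ef] : exists2 f : 'I_k -> 'I_n, injective f & forall a, e i0 (f a).
  exists (fun a => enum_val (cast_ord (esym ei0) a)).
    by move=> a b /enum_val_inj /cast_ord_inj.
  by move=> a; have := enum_valP (cast_ord (esym ei0) a).
pose v a := v0 (f a); pose psi := u i0.
have Av a : A (v a) by case: (hv0 _ (ef a)).
have vp a : v a *m p i0 = v a by case: (hv0 _ (ef a)).
have pv a : p (f a) *m v a = v a by case: (hv0 _ (ef a)).
have vv a b : adj (v a) *m v b = if a == b then p i0 else 0.
  have [->|ab] := eqVneq a b; first by case: (hv0 _ (ef b)).
  rewrite -(pv a) -(pv b) adjM hp -mulmxA (mulmxA (p (f a))) pp.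
  by rewrite (inj_eq fi) (negbTE ab) mul0mx mulmx0.
have [ppsi psi1] : p i0 *m psi = psi /\ adj psi *m psi = 1%:M := hu i0.
pose V : 'M[C]_(d, k) := \sum_a v a *m psi *m delta_mx 0 a.
have vV a : adj (v a) *m V = psi *m delta_mx 0 a.
  rewrite mulmx_sumr (bigD1 a) //= big1 ?addr0 => [|b /negbTE ba].
    by rewrite !mulmxA vv eqxx ppsi.
  by rewrite !mulmxA vv eq_sym ba !mul0mx.
have VV : adj V *m V = 1%:M.
  rewrite {1}/V adj_sum mulmx_suml [RHS]mx1_sum_delta; apply: eq_bigr => a _.
  rewrite !adjM -!mulmxA vV (mulmxA (adj psi)) psi1 mul1mx adj_delta.
  by rewrite mul_delta_mx.
pose z := \sum_a v a *m adj (v a).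
have hz : adj z = z by rewrite adj_sum; apply: eq_bigr => a _; rewrite adjM adjK.
have vz a : adj (v a) *m z = adj (v a).
  rewrite mulmx_sumr (bigD1 a) //= big1 ?addr0 => [|b /negbTE ba].
    by rewrite mulmxA vv eqxx -{1}hp -adjM vp.
  by rewrite mulmxA vv eq_sym ba mul0mx.
have zz : z *m z = z by rewrite {1}/z mulmx_suml; apply: eq_bigr => a _; rewrite -mulmxA vz.
have Az : A z.
  by rewrite /A (linmap_sum lG); apply: eq_bigr => a _; apply: (AM _ _ (Av a) (Aadj _ (Av a))).
have zV : z *m V = V.
  by rewrite mulmx_suml; apply: eq_bigr => a _; rewrite -mulmxA vV mulmxA.
have sV : s *m V = V.
  rewrite mulmx_sumr; apply: eq_bigr => a _; rewrite !mulmxA.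
  by rewrite -{1}(pv a) mulmxA sp pv.
(* The Kraus form of Y |-> sum_ab tr(adj v_a Y v_b) |a><b|; summing over l produces the trace. *)
pose Ks : seq 'M[C]_(k, d) := [seq \sum_a delta_mx a l *m adj (v a) | l <- enum 'I_d].
have eK1 : kraus (adjs Ks) 1%:M = z.
  rewrite kraus_adjs big_map big_enum /=.
  transitivity (\sum_a v a *m 1%:M *m adj (v a)); last by apply: eq_bigr => a _; rewrite mulmx1.
  under [RHS]eq_bigr do rewrite mx1_sum_delta mulmx_sumr mulmx_suml.
  rewrite exchange_big; apply: eq_bigr => l _ /=.
  rewrite mulmx1 adj_sum mulmx_suml; apply: eq_bigr => a _.
  rewrite mulmx_sumr (bigD1 a) //= big1 ?addr0 => [|b /negbTE ba].
    by rewrite adjM adjK adj_delta !mulmxA -(mulmxA (v a)) mul_delta_mx.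
  rewrite adjM adj_delta !mulmxA -(mulmxA (adj (adj (v a)))) mul_delta_mx_0 ?mulmx0 ?mul0mx //.
  by rewrite eq_sym ba.
have [Rc [cR eR]] := complete_channel (Ordinal k0) hz zz eK1.
have cV : channel (kraus [:: V]).
  by apply: channel_kraus; rewrite kraus_adjs big_seq1 mulmx1.
have eV X : kraus [:: V] X = V *m X *m adj V by rewrite /kraus big_seq1.
have sVs X : s *m (V *m X *m adj V) *m s = V *m X *m adj V.
  by rewrite !mulmxA sV -!mulmxA -{1}hs -adjM sV.
exists (kraus [:: V]), Rc; split => // X.
rewrite eV eR; set Y := P _.
have -> : \tr ((1%:M - z) *m Y) = 0.
  rewrite mulmxBl mul1mx raddfB /= /Y dual // Az !mulmxA zV.
  by case: chP => _ [_ ->]; rewrite subrr.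
rewrite scale0r addr0 /kraus big_map big_enum /=.
transitivity (\sum_a \sum_b \tr (adj (v a) *m Y *m v b) *: (delta_mx a b : 'M[C]_k)).
  rewrite /mxtrace; under [RHS]eq_bigr do (under eq_bigr do rewrite scaler_suml; rewrite exchange_big).
  rewrite [RHS]exchange_big; apply: eq_bigr => l _ /=.
  rewrite !mulmx_suml; apply: eq_bigr => a _.
  rewrite adj_sum mulmx_sumr; apply: eq_bigr => b _.
  by rewrite adjM adjK adj_delta -mulmx_delta2 !mulmxA.
rewrite [RHS]matrix_sum_delta; apply: eq_bigr => a _; apply: eq_bigr => b _; congr (_ *: _).
(* v_b (adj v_a) is fixed by Gamma, so P disappears under the trace. *)
rewrite mxtrace_mulC mulmxA /Y dual // (AM _ _ (Av b) (Aadj _ (Av a))).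
have Vv : adj V *m v b = delta_mx b 0 *m adj psi.
  by rewrite -[LHS]adjK adjM adjK vV adjM adj_delta.
rewrite -!mulmxA mxtrace_mulC -!mulmxA Vv !mulmxA vV.
rewrite mxtrace_mulC !mulmxA psi1 mul1mx.
rewrite /mxtrace big_ord1 mulmx_delta2 !mxE !eqxx mulr1.
by [].
Qed.

End IdempotentCodes.

(** * Ultralimits of channels *)

Section Ultralimit.
Local Open Scope classical_set_scope.
Local Open Scope ring_scope.
Context {R : realType}.
Local Notation C := R[i].
Variable U : set_system nat.
Hypothesis UU : UltraFilter U.
Hypothesis Uoo : forall N, U [set t | (N <= t)%N].

Let FU : ProperFilter U := @ultra_proper _ _ UU.
Local Existing Instance FU.

(** In [R[i]], [0 < eps] forces eps to be real. *)
Definition ulim (u : nat -> C) (l : C) := forall eps : C, 0 < eps ->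
  U [set t | `|u t - l| < eps].

Lemma ulim_near s u v l : (forall t, (s <= t)%N -> u t = v t) -> ulim u l -> ulim v l.
Proof.
move=> e hu eps e0; apply: filterS (filterI (hu _ e0) (Uoo s)) => t [/= h st].
by rewrite -e.
Qed.

Lemma ulim_cst c : ulim (fun _ => c) c.
Proof. by move=> eps e0; apply: nearW => t; rewrite subrr normr0. Qed.

Lemma ulimD u v a b : ulim u a -> ulim v b -> ulim (fun t => u t + v t) (a + b).
Proof.
move=> hu hv eps e0; have e2 : 0 < eps / 2 by rewrite divr_gt0.
apply: filterS (filterI (hu _ e2) (hv _ e2)) => t [/= h1 h2].
rewrite opprD addrACA; apply: le_lt_trans (ler_normD _ _) _.
by rewrite (splitr eps) ltrD.
Qed.

Lemma ulim_sum (I : Type) (r : seq I) (P : pred I) (u : I -> nat -> C) (a : I -> C) :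
  (forall i, ulim (u i) (a i)) ->
  ulim (fun t => \sum_(i <- r | P i) u i t) (\sum_(i <- r | P i) a i).
Proof.
move=> h; elim: r => [|i r IH].
  by under eq_fun do rewrite big_nil; rewrite big_nil; apply: ulim_cst.
under eq_fun do rewrite big_cons; rewrite big_cons.
by case: (P i) => //; apply: ulimD.
Qed.

Lemma ulimM u v a b : ulim u a -> ulim v b -> ulim (fun t => u t * v t) (a * b).
Proof.
move=> hu hv eps e0.
have ua : 0 < `|b| + 1 by rewrite ltr_wpDl.
have va : 0 < `|a| + 1 by rewrite ltr_wpDl.
have e1 : 0 < eps / 2 / (`|b| + 1) by rewrite !divr_gt0.
have e2 : 0 < eps / 2 / (`|a| + 1) by rewrite !divr_gt0.
apply: filterS (filterI (hu _ e1) (filterI (hv _ e2) (hv _ ltr01))) => t [/= h1 [h2 h3]].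
have -> : u t * v t - a * b = (u t - a) * v t + a * (v t - b) by ring.
apply: le_lt_trans (ler_normD _ _) _; rewrite !normrM (splitr eps) ltr_leD //.
  have vb : `|v t| < `|b| + 1.
    rewrite -[v t](subrK b) addrC; apply: le_lt_trans (ler_normD _ _) _.
    by rewrite ltrD2l.
  apply: le_lt_trans (ler_wpM2l (normr_ge0 _) (ltW vb)) _.
  by rewrite -ltr_pdivlMr.
apply: (@le_trans _ _ ((`|a| + 1) * `|v t - b|)).
  by rewrite ler_wpM2r // lerDl.
by rewrite mulrC -ler_pdivlMr // ltW.
Qed.

Lemma ulim_uniq u a b : ulim u a -> ulim u b -> a = b.
Proof.
move=> ha hb; apply/eqP; rewrite -subr_eq0 -normr_eq0; apply: contraT => h.
have e0 : 0 < `|a - b| / 2 by rewrite divr_gt0 // lt0r h /=.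
have [t [/= h1 h2]] := filter_ex (filterI (ha _ e0) (hb _ e0)).
have : `|a - b| < `|a - b|.
  rewrite {1}(_ : a - b = (u t - b) - (u t - a)); last by ring.
  by apply: le_lt_trans (ler_normB _ _) _; rewrite [ltRHS]splitr ltrD.
by rewrite ltxx.
Qed.

Lemma ulim_conj u a : ulim u a -> ulim (fun t => (u t)^*) a^*.
Proof.
by move=> h eps e0; apply: filterS (h _ e0) => t /=; rewrite -rmorphB norm_conjC.
Qed.

Lemma ulim_norm u a : ulim u a -> ulim (fun t => `|u t|) `|a|.
Proof.
move=> h eps e0; apply: filterS (h _ e0) => t /=; apply: le_lt_trans.
exact: ler_dist_dist.
Qed.

Lemma ulim_ge0 u a : ulim u a -> (forall t, 0 <= u t) -> 0 <= a.
Proof.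
move=> h u0; have := ulim_norm h.
under eq_fun do rewrite ger0_norm //.
by move/(ulim_uniq h) => ->.
Qed.

Lemma ulim_real_exists (v : nat -> R) (M : R) : (forall t, `|v t| <= M) ->
  exists l : R, forall eps, 0 < eps -> U [set t | `|v t - l| < eps].
Proof.
(* The limit is the supremum of the levels that v reaches on a set of U; just above it, the
   ultrafilter contains the complementary set. *)
move=> hM; pose S : set R := [set x | U [set t | x <= v t]]%classic.
have S0 : S (- M).
  by apply: nearW => t; have := hM t; rewrite ler_norml => /andP [].
have Sub : ubound S M.
  move=> x Sx; have [t /= xt] := filter_ex Sx; apply: le_trans xt _.
  exact: le_trans (ler_norm _) (hM t).
have hS : has_sup S by split; [exists (- M) | exists M].
exists (sup S) => eps e0.
have [x Sx xl] := sup_adherent e0 hS.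
have nS : ~ S (sup S + eps / 2).
  move=> h; have := sup_upper_bound hS h.
  by rewrite gerDl leNgt divr_gt0.
have [//|h] := in_ultra_setVsetC [set t | sup S + eps / 2 <= v t]%classic UU.
apply: filterS (filterI Sx h) => t [/= h1 /negP h2].
rewrite -ltNge in h2; rewrite ltr_distl; apply/andP; split.
  exact: lt_le_trans xl h1.
by apply: lt_le_trans h2 _; rewrite lerD2l ler_pdivrMr // ler_peMr ?ltW // ltr1n.
Qed.

Lemma ulim_exists (u : nat -> C) (M : C) : (forall t, `|u t| <= M) -> exists l, ulim u l.
Proof.
move=> hM.
have lift (f : C -> R) : (forall z, (`|f z|%:C)%C <= `|z|) ->
    exists l : R, ulim (fun t => ((f (u t))%:C)%C) (l%:C)%C.
  move=> hf; have [|l hl] := @ulim_real_exists (fun t => f (u t)) (complex.Re M).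
    move=> t; have := le_trans (hf (u t)) (hM t).
    by rewrite lecE /= => /andP [].
  exists l => eps; rewrite ltcE /= => /andP [/eqP ie re].
  apply: filterS (hl _ re) => t /= h.
  by rewrite -rmorphB normc_def /= expr0n addr0 sqrtr_sqr ltcE /= ie eqxx.
have [a ha] := lift _ (@normc_ge_Re R).
have [|b hb] := lift (@complex.Im R).
  move=> z; rewrite normc_def lecR -sqrtr_sqr ler_sqrt ?addr_ge0 ?sqr_ge0 //.
  by rewrite lerDr sqr_ge0.
exists ((a%:C)%C + ('i%C) * (b%:C)%C).
apply: (@ulim_near 0 (fun t => (complex.Re (u t))%:C%C + 'i%C * (complex.Im (u t))%:C%C)).
  by move=> t _; rewrite -complexE.
by apply: ulimD ha _; apply: ulimM hb; apply: ulim_cst.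
Qed.

(** * Entrywise limits of matrices *)

Definition mulim m n (X : nat -> 'M[C]_(m, n)) (L : 'M[C]_(m, n)) :=
  forall i j, ulim (fun t => X t i j) (L i j).

Lemma mulim_uniq m n (X : nat -> 'M[C]_(m, n)) A B : mulim X A -> mulim X B -> A = B.
Proof. by move=> hA hB; apply/matrixP=> i j; apply: ulim_uniq (hA i j) (hB i j). Qed.

Lemma mulim_near m n s (X Y : nat -> 'M[C]_(m, n)) A :
  (forall t, (s <= t)%N -> X t = Y t) -> mulim X A -> mulim Y A.
Proof.
by move=> e h i j; apply: (@ulim_near s (fun t => X t i j)) (h i j) => t /e ->.
Qed.

Lemma mulim_cst m n (A : 'M[C]_(m, n)) : mulim (fun _ => A) A.
Proof. by move=> i j; apply: ulim_cst. Qed.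

Lemma mulim_sum m n (I : Type) (r : seq I) (P : pred I) (X : I -> nat -> 'M[C]_(m, n)) A :
  (forall i, mulim (X i) (A i)) ->
  mulim (fun t => \sum_(i <- r | P i) X i t) (\sum_(i <- r | P i) A i).
Proof.
move=> h i j; under eq_fun do rewrite summxE.
by rewrite summxE; apply: ulim_sum => k; apply: h.
Qed.

Lemma mulimZ m n (c : nat -> C) (X : nat -> 'M[C]_(m, n)) a A :
  ulim c a -> mulim X A -> mulim (fun t => c t *: X t) (a *: A).
Proof.
by move=> hc hX i j; under eq_fun do rewrite mxE; rewrite mxE; apply: ulimM.
Qed.

Lemma mulim_mul m n p (X : nat -> 'M[C]_(m, n)) (Y : nat -> 'M[C]_(n, p)) A B :
  mulim X A -> mulim Y B -> mulim (fun t => X t *m Y t) (A *m B).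
Proof.
move=> hX hY i j; under eq_fun do rewrite mxE; rewrite mxE.
by apply: ulim_sum => k; apply: ulimM.
Qed.

Lemma mulim_tens m n p q (X : nat -> 'M[C]_(m, n)) (Y : nat -> 'M[C]_(p, q)) A B :
  mulim X A -> mulim Y B -> mulim (fun t => X t *t Y t) (A *t B).
Proof.
by move=> hX hY i j; under eq_fun do rewrite mxE; rewrite mxE; apply: ulimM.
Qed.

Lemma mulim_psd n (X : nat -> 'M[C]_n) A : mulim X A -> (forall t, psd (X t)) -> psd A.
Proof.
move=> h pX; split.
  apply: (@mulim_uniq _ _ X) => // i j; rewrite adjE.
  under eq_fun do rewrite -(psd_adj (pX _)) adjE.
  exact: ulim_conj.
move=> v; apply: ulim_ge0 (mulim_mul (mulim_mul (mulim_cst (adj v)) h) (mulim_cst v) 0 0) _.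
by move=> t; apply: psd_form.
Qed.

(** * Pointwise limits of linear maps *)

Definition culim m n (T : nat -> 'M[C]_m -> 'M[C]_n) (L : 'M[C]_m -> 'M[C]_n) :=
  forall X, mulim (fun t => T t X) (L X).

Lemma culim_app m n (T : nat -> 'M[C]_m -> 'M[C]_n) L (X : nat -> 'M[C]_m) A :
  (forall t, linmap (T t)) -> linmap L -> culim T L -> mulim X A ->
  mulim (fun t => T t (X t)) (L A).
Proof.
move=> lT lL hT hX; under eq_fun do rewrite (linmap_delta (lT _)).
rewrite (linmap_delta lL); apply: mulim_sum => i; apply: mulim_sum => j.
by apply: mulimZ.
Qed.

Lemma culim_tens m n p q (T : nat -> 'M[C]_m -> 'M[C]_n) L (S : nat -> 'M[C]_p -> 'M[C]_q) M :
  culim T L -> culim S M -> culim (fun t => tensmap (T t) (S t)) (tensmap L M).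
Proof.
move=> hT hS X; rewrite /tensmap.
do 4!apply: mulim_sum => ?.
by apply: mulimZ; [exact: ulim_cst | exact: mulim_tens].
Qed.

(** There are m n Kraus operators, and the diagonal of sum adj K K = 1 bounds their entries by 1.
    Only independence of T matters. *)
Lemma channel_entry_bound m n (T : 'M[C]_m -> 'M[C]_n) a b i j : channel T ->
  `|T (delta_mx a b) i j| <= (m * n)%:R.
Proof.
move=> /kraus_channel [Ks [sK -> tK]].
have K1 K k l : K \in Ks -> `|K k l| <= 1.
  move=> KKs; rewrite -(expr_le1 (n := 2)) //.
  have : \sum_(K <- Ks) \sum_k `|K k l| ^+ 2 = 1.
    have h1 : kraus (adjs Ks) 1%:M l l = 1 by rewrite tK mxE eqxx.
    rewrite -h1 kraus_adjs summxE.
    apply: eq_bigr => L _; rewrite mulmx1 mxE; apply: eq_bigr => x _.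
    by rewrite adjE normCK mulrC.
  move=> e1; apply: (@le_trans _ _ (\sum_(K <- Ks) \sum_k `|K k l| ^+ 2)); last by rewrite e1.
  rewrite (big_rem K) //= (bigD1 k) //= -addrA lerDl.
  apply: addr_ge0; first by apply: sumr_ge0 => x _; rewrite exprn_ge0.
  by apply: sumr_ge0 => L _; apply: sumr_ge0 => x _; rewrite exprn_ge0.
rewrite /kraus summxE; apply: le_trans (ler_norm_sum _ _ _) _.
rewrite -sK -sum1_size natr_sum !big_seq; apply: ler_sum => K KKs.
have -> : (K *m delta_mx a b *m adj K) i j = K i a * (K j b)^* by rewrite mulmx_delta_entry adjE.
by rewrite normrM norm_conjC mulr_ile1 ?K1.
Qed.

(** Compactness of the set of channels: take limits on matrix units and extend linearly; complete
    positivity and trace preservation are closed conditions. *)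
Lemma culim_channel m n (T : nat -> 'M[C]_m -> 'M[C]_n) :
  (forall t, channel (T t)) -> exists L, channel L /\ culim T L.
Proof.
move=> chT.
have h (x : ('I_m * 'I_m) * ('I_n * 'I_n)) :
    exists l, ulim (fun t => T t (delta_mx x.1.1 x.1.2) x.2.1 x.2.2) l.
  by apply: (@ulim_exists _ (m * n)%:R) => t; apply: channel_entry_bound.
have [l hl] := choice h.
pose L (X : 'M[C]_m) : 'M[C]_n :=
  \sum_a \sum_b X a b *: \matrix_(i, j) l ((a, b), (i, j)).
have lT t : linmap (T t) by case: (chT t).
have cL : culim T L.
  move=> X; under eq_fun do rewrite (linmap_delta (lT _)).
  apply: mulim_sum => a; apply: mulim_sum => b; apply: mulimZ; first exact: ulim_cst.
  by move=> i j; rewrite mxE; apply: (hl ((a, b), (i, j))).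
exists L; split => //; split.
  move=> c X Y; rewrite /L scaler_sumr -big_split; apply: eq_bigr => a _ /=.
  rewrite scaler_sumr -big_split; apply: eq_bigr => b _ /=.
  by rewrite scalerA -scalerDl !mxE.
split.
  move=> k X pX; apply: (mulim_psd (X := fun t => tensmap (fun Y : 'M[C]_k => Y) (T t) X)).
    by apply: culim_tens => // Y; apply: mulim_cst.
  by move=> t; case: (chT t) => _ [cT _]; apply: cT.
move=> X; apply: (ulim_uniq (u := fun t => \tr (T t X))).
  by apply: ulim_sum => i; apply: cL.
by under eq_fun do rewrite (let: conj _ (conj _ h) := chT _ in h); apply: ulim_cst.
Qed.

(** [V s] acts as T^(-s) A: V_s T^s = A and T^u V_(s+u) = V_s. In the limit over s these give W A =
    A and T^u X_u = W. A limit X' of the X_u then satisfies A X' = W, so W W = W A X' = A X' = W. *)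
Lemma culim_iter d (T : 'M[C]_d -> 'M[C]_d) : channel T ->
  exists A W, [/\ channel A, channel W, culim (fun t => iter t T) A,
    (forall Y, W (W Y) = W Y) /\ (forall Y, W (A Y) = A Y) &
    forall u, exists X, channel X /\ forall Y, iter u T (X Y) = W Y].
Proof.
move=> chT; have chTt t := channel_iter t chT.
have lin m n (F : 'M[C]_m -> 'M[C]_n) : channel F -> linmap F by case.
have [A [chA cA]] := culim_channel chTt.
(* Truncated subtraction matters only for t < s, which U ignores. *)
have [V hV] := choice (fun s => culim_channel (fun t => chTt (t - s)%N)).
have chV s : channel (V s) by case: (hV s).
have cV s : culim (fun t => iter (t - s) T) (V s) by case: (hV s).
have [W [chW cW]] := culim_channel chV.
have [X hX] := choice (fun u => culim_channel (fun s => chV (s + u)%N)).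
have chX u : channel (X u) by case: (hX u).
have cX u : culim (fun s => V (s + u)%N) (X u) by case: (hX u).
have [X' [chX' cX']] := culim_channel chX.
have AV s Y : V s (iter s T Y) = A Y.
  apply: mulim_uniq (cV s _) _; apply: (mulim_near (s := s) _ (cA Y)) => t st.
  by rewrite -iterD subnK.
have TV u s Y : iter u T (V (s + u)%N Y) = V s Y.
  apply: mulim_uniq (cV s Y).
  have := @culim_app _ _ (fun=> iter u T) (iter u T) _ _ (fun=> lin _ _ _ (chTt u))
    (lin _ _ _ (chTt u)) (fun Z => mulim_cst _) (cV (s + u)%N Y).
  apply: (mulim_near (s := (s + u)%N)) => t st; rewrite -iterD; congr (iter _ _ _).
  by rewrite subnDA subnKC // leq_subRL // (leq_trans (leq_addr u s) st).
have TX u Y : iter u T (X u Y) = W Y.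
  apply: mulim_uniq (cW Y).
  have := @culim_app _ _ (fun=> iter u T) (iter u T) _ _ (fun=> lin _ _ _ (chTt u))
    (lin _ _ _ (chTt u)) (fun Z => mulim_cst _) (cX u Y).
  by apply: (mulim_near (s := 0%N)) => s _; apply: TV.
have WA Y : W (A Y) = A Y.
  have h := culim_app (fun s => lin _ _ _ (chV s)) (lin _ _ _ chW) cW (cA Y).
  by apply: mulim_uniq h _; under eq_fun do rewrite AV; apply: mulim_cst.
have AX Y : A (X' Y) = W Y.
  have h := culim_app (fun s => lin _ _ _ (chTt s)) (lin _ _ _ chA) cA (cX' Y).
  by apply: mulim_uniq h _; under eq_fun do rewrite TX; apply: mulim_cst.
exists A, W; split => //; last by move=> u; exists (X u).
by split=> // Y; have := WA (X' Y); rewrite AX.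
Qed.

(** The encoders converge to E', and A o E' is the encoder for W since W A = A. The index maps a and
    b cover diagonal entries (classical) and all entries (quantum) at once. *)
Lemma code_limit d D (J : finType) (a b : J -> 'I_D) (c : C)
    (T : nat -> 'M[C]_d -> 'M[C]_d) (A W : 'M[C]_d -> 'M[C]_d) :
  (forall t, channel (T t)) -> channel A -> culim T A ->
  (forall Y, W (A Y) = A Y) ->
  (forall t, exists (E : 'M[C]_D -> 'M[C]_d) (Rc : 'M[C]_d -> 'M[C]_D),
    [/\ channel E, channel Rc &
      c <= \sum_x (Rc (T t (E (delta_mx (a x) (b x))))) (a x) (b x)]) ->
  exists (E : 'M[C]_D -> 'M[C]_d) (Rc : 'M[C]_d -> 'M[C]_D),
    [/\ channel E, channel Rc &
      c <= \sum_x (Rc (W (E (delta_mx (a x) (b x))))) (a x) (b x)].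
Proof.
move=> chT chA cA WA h.
have lin m n (F : 'M[C]_m -> 'M[C]_n) : channel F -> linmap F by case.
have [E h1] := choice h; have [Rc h2] := choice h1.
have chE t : channel (E t) by case: (h2 t).
have chR t : channel (Rc t) by case: (h2 t).
have [E' [chE' cE']] := culim_channel chE.
have [R' [chR' cR']] := culim_channel chR.
exists (fun X => A (E' X)), R'; split => //; first exact: channel_comp.
have cc x : mulim (fun t => Rc t (T t (E t (delta_mx (a x) (b x)))))
    (R' (A (E' (delta_mx (a x) (b x))))).
  apply: culim_app cR' _; [by move=> t; apply: lin | exact: lin |].
  by apply: culim_app cA _; [move=> t; apply: lin | exact: lin | exact: cE'].
rewrite -subr_ge0.
apply: (@ulim_ge0 (fun t => \sum_x (Rc t (T t (E t (delta_mx (a x) (b x))))) (a x) (b x) - c)).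
  apply: ulimD; last exact: ulim_cst.
  by apply: ulim_sum => x; rewrite WA; apply: cc.
by move=> t; rewrite subr_ge0; case: (h2 t).
Qed.

End Ultralimit.

Lemma free_ultrafilter : exists U : set_system nat, UltraFilter U /\
  forall N, U [set t | (N <= t)%N]%classic.
Proof.
have [U [UU h]] := @ultraFilterLemma nat eventually _.
by exists U; split => // N; apply: h; exists N.
Qed.

(** * Capacities *)

Section Capacities.
Import numFieldNormedType.Exports.
Context {R : realType}.
Local Notation C := R[i].

(** The code conditions for delta = 0, cleared of the denominators D and D^2. *)
Definition classical_exists d D (T : 'M[C]_d -> 'M[C]_d) : Prop :=
  exists (E : 'M[C]_D -> 'M[C]_d) (Rc : 'M[C]_d -> 'M[C]_D),
    [/\ channel E, channel Rc &
      D%:R <= \sum_i (Rc (T (E (delta_mx i i)))) i i].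

Definition quantum_exists d D (T : 'M[C]_d -> 'M[C]_d) : Prop :=
  exists (E : 'M[C]_D -> 'M[C]_d) (Rc : 'M[C]_d -> 'M[C]_D),
    [/\ channel E, channel Rc & D%:R ^+ 2 <=
      \sum_(x : 'I_D * 'I_D) (Rc (T (E (delta_mx x.1 x.2)))) x.1 x.2].

Lemma ketbraE D (i : 'I_D) : ketbra i = delta_mx i i :> 'M[C]_D.
Proof. by rewrite /ketbra /ket adj_delta mul_delta_mx. Qed.

Lemma classical_codeE d D (T : 'M[C]_d -> 'M[C]_d) : (0 < D)%N ->
  (exists E, @classical_code R d D 0 T E) <-> classical_exists D T.
Proof.
move=> D0.
have e (X : 'M[C]_D) i : (adj (ket i) *m X *m ket i) 0 0 = X i i.
  by rewrite /ket adj_delta mulmx_delta2 !mxE !eqxx mulr1.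
split=> [[E [cE [Rc [cR]]]]|[E [Rc [cE cR h]]]].
  rewrite subr0 rmorph1; under eq_bigr do rewrite e ketbraE.
  by rewrite mulrC ler_pdivlMr ?ltr0n // mul1r => h; exists E, Rc.
exists E; split => //; exists Rc; split => //.
rewrite subr0 rmorph1; under eq_bigr do rewrite e ketbraE.
by rewrite mulrC ler_pdivlMr ?ltr0n // mul1r.
Qed.

Lemma entanglement_fidelity D (N : 'M[C]_D -> 'M[C]_D) : (0 < D)%N -> linmap N ->
  (adj (maxent D) *m tensmap (fun Y : 'M[C]_D => Y) N (maxent D *m adj (maxent D))
     *m maxent D) 0 0 =
  (\sum_(x : 'I_D * 'I_D) N (delta_mx x.1 x.2) x.1 x.2) / D%:R ^+ 2 :> C.
Proof.
move=> D0 lN.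
have lid : linmap (fun Y : 'M[C]_D => Y) by [].
have lT := linmap_tensmap (fun Y : 'M[C]_D => Y) N.
pose c : C := (sqrtC (D%:R : C))^-1.
have cC : c^* = c by rewrite conj_Creal // ger0_real // invr_ge0 sqrtC_ge0.
have cc : c * c = D%:R^-1 by rewrite -expr2 exprVn sqrtCK.
pose w : 'cV[C]_(D * D) := \sum_(i < D) (ket i *t ket i : 'M[C]_(D * D, 1 * 1)).
have em : maxent D = c *: w by [].
have aw : adj w = \sum_(i < D) (adj (ket i) *t adj (ket i) : 'M[C]_(1 * 1, D * D)).
  by rewrite /w adj_sum; apply: eq_bigr => i _; rewrite -adj_tens.
have ew : w *m adj w = \sum_i \sum_j delta_mx i j *t delta_mx i j.
  rewrite aw /w mulmx_suml; apply: eq_bigr => i _; rewrite mulmx_sumr.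
  apply: eq_bigr => j _; rewrite (@tensmx_mul _ D 1 D 1 D D).
  by rewrite /ket !adj_delta !mul_delta_mx.
have pick (F : 'I_D -> 'I_D -> C) : \sum_i \sum_j F i j * (i == j)%:R = \sum_i F i i.
  apply: eq_bigr => i _; rewrite (bigD1 i) //= eqxx mulr1 big1 ?addr0 // => j /negbTE ji.
  by rewrite eq_sym ji mulr0.
have wE i j : w (mxtens_index (i, j)) 0 = (i == j)%:R.
  rewrite summxE (bigD1 i) //= big1 ?addr0 => [|a /negbTE ai]; rewrite mxE mxtens_indexK !mxE /=.
    by rewrite [X in X == 0]ord1 !eqxx mul1r [X in _ && (X == 0)]ord1 eqxx andbT eq_sym.
  by rewrite eq_sym ai mul0r.
have wform Y : (adj w *m Y *m w) 0 0 = \sum_i \sum_j Y (mxtens_index (i, i)) (mxtens_index (j, j)).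
  transitivity (\sum_i \sum_j (adj w *m Y) 0 (mxtens_index (i, j)) * (i == j)%:R).
    rewrite mxE big_mxtens_index; apply: eq_bigr => i _; apply: eq_bigr => j _.
    by rewrite wE.
  rewrite pick exchange_big; apply: eq_bigr => j _ /=.
  transitivity (\sum_a \sum_b Y (mxtens_index (a, b)) (mxtens_index (j, j)) * (a == b)%:R).
    rewrite mxE big_mxtens_index; apply: eq_bigr => a _; apply: eq_bigr => b _.
    by rewrite adjE wE conjC_nat mulrC.
  by rewrite pick.
have -> : adj (maxent D) *m tensmap (fun Y : 'M[C]_D => Y) N (maxent D *m adj (maxent D)) *m maxent D
   = (D%:R ^- 2) *: (adj w *m tensmap (fun Y : 'M[C]_D => Y) N (\sum_i \sum_j delta_mx i j *t delta_mx i j) *m w).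
  have eZ : tensmap (fun Y : 'M[C]_D => Y) N (c *: w *m (c *: adj w)) = D%:R^-1 *:
      tensmap (fun Y : 'M[C]_D => Y) N (\sum_i \sum_j delta_mx i j *t delta_mx i j).
    by rewrite -scalemxAr -scalemxAl scalerA cc (linmapZ lT) ew.
  rewrite em adjZ cC eZ -!scalemxAr -!scalemxAl !scalerA; congr (_ *: _).
  have -> : c / D%:R * c = c * c / D%:R by ring.
  by rewrite cc -invfM -expr2.
rewrite mxE wform mulrC; congr (_ / _).
rewrite -(pair_bigA _ (fun i j => N (delta_mx i j) i j)) /=.
by apply: eq_bigr => i _; apply: eq_bigr => j _; rewrite choi_entry.
Qed.

Lemma quantum_codeE d D (T : 'M[C]_d -> 'M[C]_d) : (0 < D)%N -> linmap T ->
  (exists E, @quantum_code R d D 0 T E) <-> quantum_exists D T.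
Proof.
move=> D0 lT.
have e (E : 'M[C]_D -> 'M[C]_d) (Rc : 'M[C]_d -> 'M[C]_D) : channel E -> channel Rc ->
    linmap (fun X => Rc (T (E X))).
  by move=> [lE _] [lR _]; apply: (linmap_comp (linmap_comp lE lT) lR).
split=> [[E [cE [Rc [cR]]]]|[E [Rc [cE cR h]]]].
  rewrite (entanglement_fidelity D0 (e _ _ cE cR)).
  rewrite subr0 rmorph1 ler_pdivlMr ?exprn_gt0 ?ltr0n // mul1r => h.
  by exists E, Rc.
exists E; split => //; exists Rc; split => //.
rewrite (entanglement_fidelity D0 (e _ _ cE cR)).
by rewrite subr0 rmorph1 ler_pdivlMr ?exprn_gt0 ?ltr0n // mul1r.
Qed.

(** * Logarithms and the stationary limit *)

Lemma log2_le m n : (0 < m)%N -> (m <= n)%N -> log2 m%:R <= log2 n%:R :> R.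
Proof.
move=> m0 mn; rewrite /log2 ler_pM2r ?invr_gt0 ?ln_gt0 ?ltr1n //.
by rewrite ler_ln ?posrE ?ltr0n ?ler_nat // (leq_trans m0).
Qed.

Lemma log2M m n : (0 < m)%N -> (0 < n)%N -> log2 (m * n)%:R = log2 m%:R + log2 n%:R :> R.
Proof. by move=> m0 n0; rewrite /log2 natrM lnM ?posrE ?ltr0n // mulrDl. Qed.

(** Code sizes shrink with t and are bounded by m, so each of the finitely many sizes above n has
    disappeared after some [t0]; from there on the supremum is constant. *)
Lemma limit_sup_log2 (code : nat -> nat -> Prop) (n m : nat) :
  (0 < n)%N -> (forall t, code t n) -> (forall t D, code t D -> (D <= m)%N) ->
  (forall D, (forall t, code t D) -> (D <= n)%N) ->
  (forall t D, code t.+1 D -> code t D) ->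
  limn (fun t => sup [set x : R | exists D : nat, (0 < D)%N /\ x = log2 D%:R /\
    code t D]%classic) = log2 n%:R.
Proof.
move=> n0 cn cm cD mono.
have monoL s t D : (s <= t)%N -> code t D -> code s D.
  by move=> /subnK <-; elim: (t - s)%N => //= j IH; rewrite addSn => /mono.
have stop D : exists t, (n < D)%N -> ~ code t D.
  have [nD|_] := boolP (n < D)%N; last by exists 0%N.
  have [t ht] : exists t, ~ code t D.
    apply: contrapT => /forallNP h; move: nD; rewrite ltnNge cD // => t.
    by apply: contrapT; apply: h.
  by exists t.
have [g hg] := choice stop.
pose t0 := (\max_(D < m.+1) g D)%N.
have ht0 t D : (t0 <= t)%N -> code t D -> (D <= n)%N.
  move=> le cd; have Dm : (D < m.+1)%N by rewrite ltnS; apply: cm cd.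
  rewrite leqNgt; apply/negP => nD; apply: (hg D nD); apply: monoL cd.
  apply: leq_trans le.
  exact: (@leq_bigmax _ (fun D : 'I_m.+1 => g D) (Ordinal Dm)).
apply/cvg_lim; first exact: norm_hausdorff.
apply: cvg_near_cst; exists t0 => // t /= le.
apply/eqP; rewrite eq_le; apply/andP; split.
  apply: ge_sup; first by exists (log2 n%:R), n.
  by move=> x [D [D0 [-> cd]]]; apply: log2_le => //; apply: ht0 cd.
apply: ub_le_sup; last by exists n.
exists (log2 n%:R) => x [D [D0 [-> cd]]].
by apply: log2_le => //; apply: ht0 cd.
Qed.


(** * Transfer of codes between channels *)

Lemma classical_exists_iterS d D (T : 'M[C]_d -> 'M[C]_d) t : channel T ->
  classical_exists D (iter t.+1 T) -> classical_exists D (iter t T).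
Proof.
move=> chT [E [Rc [cE cR h]]]; exists E, (fun X => Rc (T X)); split => //.
exact: channel_comp.
Qed.

Lemma quantum_exists_iterS d D (T : 'M[C]_d -> 'M[C]_d) t : channel T ->
  quantum_exists D (iter t.+1 T) -> quantum_exists D (iter t T).
Proof.
move=> chT [E [Rc [cE cR h]]]; exists E, (fun X => Rc (T X)); split => //.
exact: channel_comp.
Qed.

Lemma atomic_classical_exists d (P : 'M[C]_d -> 'M[C]_d) Gs (I : finType) (p : I -> 'M[C]_d)
    e k D : channel P -> atomic P Gs p e k -> classical_exists D P -> (D <= #|I|)%N.
Proof.
by move=> chP aP [E [Rc [cE cR h]]]; apply: (atomic_classical_bound aP chP cE cR h).
Qed.

(** Absorbing T into the encoder leaves a code for the identity channel. *)
Lemma classical_exists_dim d D (T : 'M[C]_d -> 'M[C]_d) : channel T ->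
  classical_exists D T -> (D <= d)%N.
Proof.
move=> chT [E [Rc [cE cR h]]]; rewrite -[X in (_ <= X)%N]card_ord.
exact: (atomic_classical_bound (atomic_id d) (channel_id d) (channel_comp cE chT) cR h).
Qed.

Lemma atomic_quantum_exists d (P : 'M[C]_d -> 'M[C]_d) Gs (I : finType) (p : I -> 'M[C]_d)
    e k D : channel P -> atomic P Gs p e k -> quantum_exists D P -> (D <= k)%N.
Proof.
move=> chP aP [E [Rc [cE cR h]]]; apply: (atomic_quantum_bound aP chP cE cR).
by rewrite pair_bigA.
Qed.

Lemma quantum_exists_dim d D (T : 'M[C]_d -> 'M[C]_d) : channel T ->
  quantum_exists D T -> (D <= d)%N.
Proof.
move=> chT [E [Rc [cE cR h]]].
apply: (atomic_quantum_exists (channel_id d) (atomic_id d)).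
by exists (fun X => T (E X)), Rc; split => //; apply: channel_comp.
Qed.

Lemma perfect_classical_exists d D (T : 'M[C]_d -> 'M[C]_d) :
  perfect_classical D T -> classical_exists D T.
Proof.
move=> [E [Rc [cE cR h]]]; exists E, Rc; split => //.
by under eq_bigr do rewrite h; rewrite sumr_const card_ord.
Qed.

Lemma perfect_quantum_exists d D (T : 'M[C]_d -> 'M[C]_d) :
  perfect_quantum D T -> quantum_exists D T.
Proof.
move=> [E [Rc [cE cR h]]]; exists E, Rc; split => //.
rewrite (eq_bigr (fun=> 1)) => [|x _]; last by rewrite h mxE !eqxx.
by rewrite sumr_const card_prod card_ord natrM expr2.
Qed.

Lemma perfect_classical_tens d d' D D' (T : 'M[C]_d -> 'M[C]_d) (S : 'M[C]_d' -> 'M[C]_d') :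
  linmap T -> linmap S ->
  perfect_classical D T -> perfect_classical D' S ->
  perfect_classical (D * D') (tensmap T S).
Proof.
move=> lT lS [E [Rc [cE cR h]]] [E' [Rc' [cE' cR' h']]].
have lE : linmap E by case: cE. have lE' : linmap E' by case: cE'.
have lR : linmap Rc by case: cR. have lR' : linmap Rc' by case: cR'.
exists (tensmap E E'), (tensmap Rc Rc'); split; do ?exact: channel_tens.
move=> k; case: (mxtens_indexP k) => i j.
by rewrite -tens_delta !tensmap_tens // tensmxE h h' mul1r.
Qed.

Lemma perfect_quantum_tens d d' D D' (T : 'M[C]_d -> 'M[C]_d) (S : 'M[C]_d' -> 'M[C]_d') :
  linmap T -> linmap S ->
  perfect_quantum D T -> perfect_quantum D' S ->
  perfect_quantum (D * D') (tensmap T S).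
Proof.
move=> lT lS [E [Rc [cE cR h]]] [E' [Rc' [cE' cR' h']]].
have lE : linmap E by case: cE. have lE' : linmap E' by case: cE'.
have lR : linmap Rc by case: cR. have lR' : linmap Rc' by case: cR'.
exists (tensmap E E'), (tensmap Rc Rc'); split; do ?exact: channel_tens.
move=> X; rewrite !tensmap_comp //; do ?[exact: linmap_comp].
by rewrite (eq_tensmap h h') tensmap_id.
Qed.

Lemma perfect_classical_factor d D (T W X : 'M[C]_d -> 'M[C]_d) :
  channel X -> (forall Y, T (X Y) = W Y) -> perfect_classical D W -> perfect_classical D T.
Proof.
move=> cX TX [E [Rc [cE cR h]]]; exists (fun Y => X (E Y)), Rc.
by split=> // [|i]; [exact: channel_comp | rewrite TX].
Qed.

Lemma perfect_quantum_factor d D (T W X : 'M[C]_d -> 'M[C]_d) :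
  channel X -> (forall Y, T (X Y) = W Y) -> perfect_quantum D W -> perfect_quantum D T.
Proof.
move=> cX TX [E [Rc [cE cR h]]]; exists (fun Y => X (E Y)), Rc.
by split=> // [|Y]; [exact: channel_comp | rewrite TX].
Qed.

Lemma classical_exists_limit (U : set_system nat) (UU : UltraFilter U)
    (Uoo : forall N, U [set t | (N <= t)%N]%classic) d D
    (T : nat -> 'M[C]_d -> 'M[C]_d) A W :
  (forall t, channel (T t)) -> channel A -> culim U T A -> (forall Y, W (A Y) = A Y) ->
  (forall t, classical_exists D (T t)) -> classical_exists D W.
Proof.
move=> cT cA TA WA.
exact: (@code_limit R U UU Uoo d D 'I_D id id D%:R T A W cT cA TA WA).
Qed.

Lemma quantum_exists_limit (U : set_system nat) (UU : UltraFilter U)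
    (Uoo : forall N, U [set t | (N <= t)%N]%classic) d D
    (T : nat -> 'M[C]_d -> 'M[C]_d) A W :
  (forall t, channel (T t)) -> channel A -> culim U T A -> (forall Y, W (A Y) = A Y) ->
  (forall t, quantum_exists D (T t)) -> quantum_exists D W.
Proof.
move=> cT cA TA WA.
exact: (@code_limit R U UU Uoo d D _ fst snd (D%:R ^+ 2) T A W cT cA TA WA).
Qed.

Lemma Cinf0E d (T : 'M[C]_d -> 'M[C]_d) n : channel T -> (0 < n)%N ->
  (forall t, perfect_classical n (iter t T)) ->
  (forall D, (forall t, classical_exists D (iter t T)) -> (D <= n)%N) ->
  Cinf 0 T = log2 n%:R.
Proof.
move=> chT n0 hn hD.
rewrite -(@limit_sup_log2 (fun t D => classical_exists D (iter t T)) n d) //.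
- rewrite /Cinf /Ccap; congr (limn _); apply/funext => t; congr (sup _).
  apply/seteqP; split=> x [D [D0 [-> h]]]; exists D; split => //; split => //.
    by apply/classical_codeE.
  by apply/classical_codeE.
- by move=> t; apply: perfect_classical_exists.
- by move=> t D; apply: classical_exists_dim; apply: channel_iter.
- by move=> t D; apply: classical_exists_iterS.
Qed.

Lemma Qinf0E d (T : 'M[C]_d -> 'M[C]_d) n : channel T -> (0 < n)%N ->
  (forall t, perfect_quantum n (iter t T)) ->
  (forall D, (forall t, quantum_exists D (iter t T)) -> (D <= n)%N) ->
  Qinf 0 T = log2 n%:R.
Proof.
move=> chT n0 hn hD.
rewrite -(@limit_sup_log2 (fun t D => quantum_exists D (iter t T)) n d) //.
- rewrite /Qinf /Qcap; congr (limn _); apply/funext => t; congr (sup _).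
  have lt : linmap (iter t T) by case: (channel_iter t chT).
  apply/seteqP; split=> x [D [D0 [-> h]]]; exists D; split => //; split => //.
    by apply/(quantum_codeE D0 lt).
  by apply/(quantum_codeE D0 lt).
- by move=> t; apply: perfect_quantum_exists.
- by move=> t D; apply: quantum_exists_dim; apply: channel_iter.
- by move=> t D; apply: quantum_exists_iterS.
Qed.

End Capacities.

Unset Implicit Arguments.

Theorem theorem2 (R : realType) (d d' : nat)
    (T : 'M[R[i]]_d -> 'M[R[i]]_d) (S : 'M[R[i]]_d' -> 'M[R[i]]_d') :
  (0 < d)%N -> (0 < d')%N -> channel T -> channel S ->
  Cinf 0 (tensmap T S) = Cinf 0 T + Cinf 0 S /\
  Qinf 0 (tensmap T S) = Qinf 0 T + Qinf 0 S.
Proof.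
move=> d0 d0' chT chS.
have [U [UU Uoo]] := free_ultrafilter.
have [A [W [chA chW cA [WW WA] hX]]] := culim_iter UU Uoo chT.
have [A' [W' [chA' chW' cA' [WW' WA'] hX']]] := culim_iter UU Uoo chS.
have [Gs [n [p [e [k [n0 k0 aW pcW pqW]]]]]] := idempotent_codes d0 chW WW.
have [Gs' [n' [p' [e' [k' [n0' k0' aW' pcW' pqW']]]]]] := idempotent_codes d0' chW' WW'.
have lin m r (F : 'M[R[i]]_m -> 'M[R[i]]_r) : channel F -> linmap F by case.
have chTt t := channel_iter t chT; have chSt t := channel_iter t chS.
have chTS t := channel_iter t (channel_tens chT chS).
have eTS t : iter t (tensmap T S) = tensmap (iter t T) (iter t S).
  by apply/funext => X; apply: tensmap_iter.
(* Uses that both limits are taken along the same ultrafilter. *)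
have cTS : culim U (fun t => iter t (tensmap T S)) (tensmap A A').
  by under eq_fun do rewrite eTS; apply: culim_tens.
(* This is all that the limit of codes asks of W (x) W'; it need not be identified with the map that
   [culim_iter] would give for T (x) S. *)
have WTS Y : tensmap W W' (tensmap A A' Y) = tensmap A A' Y.
  by rewrite tensmap_comp; do ?exact: lin; apply: eq_tensmap.
have chAA := channel_tens chA chA'; have chWW := channel_tens chW chW'.
have aWW := atomic_tens (lin _ _ _ chW) (lin _ _ _ chW') aW aW'.
have pcT t : perfect_classical n (iter t T).
  by have [X [cX e1]] := hX t; apply: perfect_classical_factor cX e1 pcW.
have pcS t : perfect_classical n' (iter t S).
  by have [X [cX e1]] := hX' t; apply: perfect_classical_factor cX e1 pcW'.
have pqT t : perfect_quantum k (iter t T).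
  by have [X [cX e1]] := hX t; apply: perfect_quantum_factor cX e1 pqW.
have pqS t : perfect_quantum k' (iter t S).
  by have [X [cX e1]] := hX' t; apply: perfect_quantum_factor cX e1 pqW'.
split.
  rewrite (@Cinf0E _ _ T n) //; last first.
    move=> D /(classical_exists_limit UU Uoo chTt chA cA WA) h.
    by have := atomic_classical_exists chW aW h; rewrite card_ord.
  rewrite (@Cinf0E _ _ S n') //; last first.
    move=> D /(classical_exists_limit UU Uoo chSt chA' cA' WA') h.
    by have := atomic_classical_exists chW' aW' h; rewrite card_ord.
  rewrite -log2M //; apply: Cinf0E; rewrite ?muln_gt0 ?n0 //.
  - exact: channel_tens.
  - move=> t; rewrite eTS; apply: perfect_classical_tens; do ?exact: lin.
    + exact: pcT.
    + exact: pcS.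
  - move=> D /(classical_exists_limit UU Uoo chTS chAA cTS WTS) h.
    by have := atomic_classical_exists chWW aWW h; rewrite card_prod !card_ord.
rewrite (@Qinf0E _ _ T k) //; last first.
  by move=> D /(quantum_exists_limit UU Uoo chTt chA cA WA); apply: atomic_quantum_exists aW.
rewrite (@Qinf0E _ _ S k') //; last first.
  by move=> D /(quantum_exists_limit UU Uoo chSt chA' cA' WA'); apply: atomic_quantum_exists aW'.
rewrite -log2M //; apply: Qinf0E; rewrite ?muln_gt0 ?k0 //.
- exact: channel_tens.
- move=> t; rewrite eTS; apply: perfect_quantum_tens; do ?exact: lin.
  + exact: pqT.
  + exact: pqS.
- by move=> D /(quantum_exists_limit UU Uoo chTS chAA cTS WTS); apply: atomic_quantum_exists aWW.
Qed.
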